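(* Let $N\ge 2$, $\alpha,\mu>0$, $\beta\ge 0$ and $\gamma\ge 0$. In the $(N+1)$-customer game with tardiness and index costs, with no closing time and with arrivals allowed at any $t\in\mathbb{R}$, the symmetric equilibrium arrival distribution is given by $$f(t)=\frac{\alpha\mu}{N(\alpha+\beta+\gamma\mu)},\qquad t\in[t_a,0),$$ and $$f(t)=\frac{\mu(\alpha+\beta)\left(1-\mathbb{P}(Q(t)=0)\right)-\beta\mu}{N(\alpha+\beta+\gamma\mu)},\qquad t\in[0,t_b],$$ where $t_a$ is the lower end of the arrival support and $t_b<\infty$ is the upper bound of the arrival support.
   Context: Model. There are $N+1$ customers, each choosing (possibly at random, independently) an arrival time $t\in\mathbb{R}$. A single server starts operating at time $0$ and serves First Come First Served; service times are i.i.d. exponential with rate $\mu$. Customers arriving at exactly the same time are admitted in uniformly random order. Each customer pays a delay cost $\alpha$ per unit of time from arrival until admission into service, a tardiness cost $\beta$ per unit of time from time $0$ until admission into service, and an index cost $\gamma$ for every customer ahead of him in the arrival order. When the other $N$ customers arrive independently according to a cdf $F$, the expected cost of arriving at $t$ is $$c_F(t)=-\alpha t\,\mathbf{1}_{\{t<0\}}+\frac{\alpha+\beta}{\mu}\mathbb{E}Q(t)+\beta t\,\mathbf{1}_{\{t\ge0\}}+\gamma\,\mathbb{E}A(t),$$ where $A(t)$ is the number of the other customers that have arrived up to time $t$ and $Q(t)$ is the number of them present in the system (in queue or in service) at time $t$; if $F$ has an atom at $t$, then of the customers arriving exactly at $t$ only those placed ahead by the random tie-breaking are counted. The law of $Q(t)$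 is determined by $F$. A symmetric equilibrium arrival distribution is a cdf $F$ for which there is a constant $c_e$ such that $c_F(t)=c_e$ for all $t$ in the support of $F$ and $c_F(t)\ge c_e$ for all $t\in\mathbb{R}$. Only distributions $F$ whose support is, on any finite interval, a finite union of closed intervals and points are considered. $f=F'$ denotes the density.
   Formalization: The finiteness of t_b is asserted only for β>0; for β=0 every equilibrium has t_b=∞ (after a finite t_b the cost would strictly decrease below its equilibrium value), and the density formula is then asserted on [0,∞). *)

(* Defs.v *)
From HB Require Import structures.
From mathcomp Require Import all_boot all_order all_algebra perm.
From mathcomp Require Import all_classical all_reals all_analysis.
Set Implicit Arguments.
Unset Strict Implicit.
Unset Printing Implicit Defensive.
Import Order.TTheory GRing.Theory Num.Theory.
Import numFieldNormedType.Exports.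
Local Open Scope classical_set_scope.
Local Open Scope ring_scope.

(** The queue seen by a tagged customer, for fixed arrival times [T] and service
    times [S] of the [N] other customers.  Simultaneous arrivals are ordered by
    the ranks [s j]: index [ord0] is the tagged customer, index [lift ord0 i] is
    the other customer [i]. *)
Section SamplePath.
Variables (R : realType) (N : nat).
Variables (T S : 'I_N -> R) (s : {perm 'I_N.+1}).

Definition ahead (t : R) (i : 'I_N) : bool :=
  (T i < t) || (T i == t) && (s (lift ord0 i) < s ord0)%N.

Definition arrival_order (i j : 'I_N) : bool :=
  (T i < T j) || (T i == T j) && (s (lift ord0 i) <= s (lift ord0 j))%N.

Definition line (t : R) : seq 'I_N :=
  sort arrival_order [seq i <- enum 'I_N | ahead t i].

(** Departure times, listed in the order of service.  A customer enters service
    at the maximum of his arrival time and the previous departure time; the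
    initial value [0] is the time at which the server starts operating. *)
Definition departures (t : R) : seq R :=
  scanl (fun free i => Num.max free (T i) + S i) 0 (line t).

Definition num_arrived (t : R) : nat := size (line t).

Definition num_present (t : R) : nat := count (fun d => t < d) (departures t).

End SamplePath.

(** Arrival times, service times and tie-breaking order on a probability space.
    In [independent] the sets may be taken to be [setT], so that the product
    rule for all subfamilies is included. *)
Record queue_model (R : realType) (N : nat) (mu : R)
    (F : cumulativeBounded (0 : R) (1 : R))
    (d : measure_display) (Omega : measurableType d) (P : probability Omega R)
    := QueueModel {
  arrival : 'I_N -> {RV P >-> R};
  service : 'I_N -> {RV P >-> R};
  tie : Omega -> {perm 'I_N.+1};
  measurable_tie : forall s, measurable (tie @^-1` [set s]);
  arrival_cdf : forall i t, cdf (arrival i) t = (F t)%:E;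
  service_exponential : forall i (B : set R), measurable B ->
    distribution P (service i) B = exponential_prob mu B;
  tie_uniform : forall s, P (tie @^-1` [set s]) = ((N.+1)`!%:R^-1)%:E;
  independent : forall (A B : 'I_N -> set R) (s : {perm 'I_N.+1}),
    (forall i, measurable (A i)) -> (forall i, measurable (B i)) ->
    P [set w | [/\ forall i, A i (arrival i w),
                   forall i, B i (service i w) & tie w = s]] =
    ((\prod_(i < N) P (arrival i @^-1` A i)) *
     (\prod_(i < N) P (service i @^-1` B i)) * P (tie @^-1` [set s]))%E
}.

Section Game.
Variables (R : realType) (N : nat) (mu : R).
Variable F : cumulativeBounded (0 : R) (1 : R).
Variables (d : measure_display) (Omega : measurableType d).
Variables (P : probability Omega R) (M : queue_model N mu F P).

Definition arrived (t : R) (w : Omega) : nat :=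
  num_arrived (fun i => arrival M i w) (tie M w) t.

Definition queue (t : R) (w : Omega) : nat :=
  num_present (fun i => arrival M i w) (fun i => service M i w) (tie M w) t.

Definition EA (t : R) : R := fine 'E_P[fun w => (arrived t w)%:R].

Definition EQ (t : R) : R := fine 'E_P[fun w => (queue t w)%:R].

Definition PQ0 (t : R) : R := fine (P [set w | queue t w = 0%N]).

Definition cost (alpha beta gamma t : R) : R :=
  - alpha * t * (t < 0)%R%:R + (alpha + beta) / mu * EQ t
  + beta * t * (0 <= t)%R%:R + gamma * EA t.

(** Points of increase of the cdf, i.e. the topological support of its law. *)
Definition arrival_support : set R :=
  [set x | forall e, 0 < e -> F (x - e) < F (x + e)].

(** Points are the intervals [`[x, x]]. *)
Definition regular_support : Prop :=
  forall a b : R, exists l : seq (R * R),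
    arrival_support `&` `[a, b] = \bigcup_(x in [set` l]) `[x.1, x.2]%classic.

Definition symmetric_equilibrium (alpha beta gamma : R) : Prop :=
  exists ce : R,
    (forall t, arrival_support t -> cost alpha beta gamma t = ce) /\
    (forall t, ce <= cost alpha beta gamma t).

Definition is_density (f : R -> R) : Prop :=
  [/\ measurable_fun setT f, forall t, 0 <= f t &
      forall t, (F t)%:E = (\int[lebesgue_measure]_(x in `]-oo, t]) (f x)%:E)%E].

End Game.

Arguments arrival_support {R} F.
Arguments regular_support {R} F.
Arguments is_density {R} F f.

(* Main.v *)
(** Fix the service order. The service time of customer [i] is independent of the
    time [X] at which his service starts, so that by Tonelli's theorem
    [P (X + S <= t) = mu * \int_0^t P (X <= u < X + S) du]; at each time at most
    one customer is in service, hence the expected number of departures up to [t]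
    is [mu * \int_0^t P (Q(u) > 0) du].  Consequently an atom of [F] would make
    the cost jump upwards, and without atoms the cost is explicit:
    [K F(t) - alpha t] before [0] and
    [K F(t) + beta t - (alpha + beta) \int_0^t P (Q(u) > 0) du] after [0], where
    [K = N (alpha + beta + gamma mu) / mu].  The support has no gap:
    before [0] the cost would decrease on a gap; after [0], [P (Q(u) > 0)]
    decreases strictly on a gap, so the cost would be strictly convex there with
    equal values at both ends, although it is never below these values.
    Solving [cost = constant] for [F] on the support and differentiating gives
    the density. *)

Require Import Defs.
From HB Require Import structures.
From mathcomp Require Import all_boot all_order all_algebra perm.
From mathcomp Require Import all_classical all_reals all_analysis.
From mathcomp Require Import measurable_realfun ring lra.
Set Implicit Arguments.
Unset Strict Implicit.
Unset Printing Implicit Defensive.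
Import Order.TTheory GRing.Theory Num.Theory.
Import numFieldNormedType.Exports.
Local Open Scope classical_set_scope.
Local Open Scope ring_scope.

(** * The sample path of the queue *)

(** The law of [Q(t)] is never computed. A few inequalities for the busy probability and for the
    expected number of departures are extracted from the model; [equilibrium_profile] collects them,
    and the analysis of equilibria sees the queue through them alone. Independence of a start time
    and the customer's own service time rests on the order of service being decided by arrivals and
    ties only: the start time is measurable for the sigma-algebra generated by everything except
    that service time. Expected departures are Lipschitz with constant [mu], since the server is
    busy with probability at most one; hence the fixed amount that an atom adds to the expected
    queue cannot be offset by departures in a short time. The strict decrease of the busy
    probability on a gap comes from a customer who arrived before [0] and whose service ends inside
    the gap, so [0 < F 0] has to be settled before gaps are treated. *)

Lemma filter_sorted_take (T : eqType) (e : rel T) (p : pred T) (l : seq T) :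
  transitive e -> (forall x y, e x y -> p y -> p x) -> sorted e l ->
  seq.filter p l = take (count p l) l.
Proof.
move=> etr ep; elim: l => //= x l IHl pathl.
case: ifPn => px /=; first by rewrite IHl ?(path_sorted pathl).
(* A failure of [p] at the head propagates to everything behind it. *)
have /eqP -> : count p l == 0%N.
  rewrite -leqn0 leqNgt -has_count; apply/hasPn => y yl.
  by apply: contra px; apply: ep; exact: (allP (order_path_min etr pathl)).
rewrite take0; apply/eqP; rewrite -(negbK (_ == _)) -has_filter.
apply/hasPn => y yl; apply: contra px; apply: ep.
exact: (allP (order_path_min etr pathl)).
Qed.

Section SingleServer.
Variables (R : realDomainType) (I : eqType) (T S : I -> R).
Implicit Types (a u : R) (l : seq I).

Definition serve a i : R := Num.max a (T i) + S i.

(* [service_start a l i]: the time when [i] enters service, when the server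
   becomes free at time [a] and serves [l] in order. *)
Definition service_start a l i : R :=
  Num.max (foldl serve a (take (index i l) l)) (T i).

Lemma service_start_head a i l : service_start a (i :: l) i = Num.max a (T i).
Proof. by rewrite /service_start /= eqxx. Qed.

Lemma service_start_behead a i j l :
  i != j -> service_start a (i :: l) j = service_start (serve a i) l j.
Proof. by rewrite /service_start /= => /negPf ->. Qed.

Lemma scanl_serve a l : uniq l ->
  scanl serve a l = [seq service_start a l i + S i | i <- l].
Proof.
elim: l a => //= i l IHl a /andP[il ul].
rewrite IHl// service_start_head; congr (_ :: _).
apply/eq_in_map => j jl; rewrite service_start_behead//.
by apply: contraNneq il => ->.
Qed.

(** Customers served later do not influence earlier ones, so cutting the list behind [i] leaves his
    start unchanged. *)
Lemma service_start_take a l k i : i \in take k l ->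
  service_start a (take k l) i = service_start a l i.
Proof.
move=> il; rewrite /service_start -{3 4}(cat_take_drop k l) index_cat il.
by rewrite takel_cat// ltnW// index_mem.
Qed.

Lemma serve_ge a i : 0 <= S i -> a <= serve a i.
Proof. by move=> S0; rewrite ler_wpDr// le_max lexx. Qed.

Lemma service_start_ge (S0 : forall i, 0 <= S i) a l i :
  a <= service_start a l i.
Proof.
rewrite /service_start le_max; apply/orP; left.
elim: (take _ _) a => //= j s IHs a.
exact: le_trans (serve_ge _ (S0 j)) (IHs _).
Qed.

(** Induction on the first customer. If he arrives after [u], so does everybody; if he has left by
    [u], the server is free again by [u] and the rest of the list is the same problem; otherwise he
    is in service and all others start after [u]. *)
Lemma count_in_service (S0 : forall i, 0 < S i) a u l : a <= u -> uniq l ->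
  sorted (fun i j => T i <= T j) l ->
  count (fun i => service_start a l i <= u < service_start a l i + S i) l
  = has (fun i => T i <= u < service_start a l i + S i) l :> nat.
Proof.
have S0' i : 0 <= S i by exact: ltW.
elim: l a => //= i l IHl a au /andP[il ul] pathl.
have neq j : j \in l -> i != j by move=> jl; apply: contraNneq il => ->.
rewrite service_start_head ge_max au /=.
under eq_in_count => j jl do rewrite service_start_behead ?neq//.
under eq_in_has => j jl do rewrite service_start_behead ?neq//.
have [Tiu|uTi] := leP (T i) u; last first.
  have Tu j : j \in l -> u < T j.
    move=> jl; apply: lt_le_trans uTi _.
    by apply: (allP (order_path_min _ pathl)) => // x y z; exact: le_trans.
  rewrite /= add0n (@eq_in_count _ _ pred0) ?count_pred0; last first.
    by move=> j jl /=; rewrite /service_start ge_max [T j <= u]leNgt Tu// andbF.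
  by rewrite (@eq_in_has _ _ pred0) ?has_pred0// => j jl /=; rewrite leNgt Tu.
rewrite /= -/(serve a i).
have [di|ud] := leP (serve a i) u.
  rewrite add0n orFb; apply: IHl => //; exact: path_sorted pathl.
rewrite /= (@eq_in_count _ _ pred0) ?count_pred0//.
move=> j jl /=; rewrite leNgt (lt_le_trans ud)//.
exact: service_start_ge.
Qed.

End SingleServer.

Section Queue.
Variables (R : realType) (N : nat) (T S : 'I_N -> R) (s : {perm 'I_N.+1}).

(** All customers are sorted, whereas [line] keeps only those ahead of the tagged one; start and
    departure times thus do not depend on the time of observation. *)
Definition order_list : seq 'I_N := sort (arrival_order T s) (enum 'I_N).

Definition start (i : 'I_N) : R := service_start T S 0 order_list i.

Definition departure (i : 'I_N) : R := start i + S i.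

Lemma arrival_order_total : total (arrival_order T s).
Proof.
move=> i j; rewrite /arrival_order.
by case: (ltgtP (T i) (T j)) => //= _; exact: leq_total.
Qed.

Lemma arrival_order_trans : transitive (arrival_order T s).
Proof.
move=> j i k; rewrite /arrival_order.
case: (ltgtP (T i) (T j)) => //= [Tij _|->]; last first.
  by case: (ltgtP (T j) (T k)) => //= _; exact: leq_trans.
by move=> /orP[/(lt_trans Tij) ->|/andP[/eqP <- _]]//; rewrite Tij.
Qed.

Lemma mem_order_list i : i \in order_list.
Proof. by rewrite mem_sort mem_enum. Qed.

Lemma uniq_order_list : uniq order_list.
Proof. by rewrite sort_uniq enum_uniq. Qed.

Lemma count_order_list (p : pred 'I_N) : count p order_list = (\sum_i p i)%N.
Proof.
have /seq.permP -> : perm_eq order_list (enum 'I_N) by rewrite perm_sort.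
by rewrite -sum1_count big_mkcond big_enum /=; apply: eq_bigr => i _; case: (p i).
Qed.

Lemma sorted_order_list : sorted (arrival_order T s) order_list.
Proof. exact/sort_sorted/arrival_order_total. Qed.

Lemma ahead_mono t i j : arrival_order T s i j -> ahead T s t j -> ahead T s t i.
Proof.
rewrite /arrival_order /ahead.
case: (ltgtP (T i) (T j)) => //= [Tij _|-> sij].
  by move=> /orP[/(lt_trans Tij) ->|/andP[/eqP <- _]]//; rewrite Tij.
by move=> /orP[->//|/andP[->/=] /(leq_ltn_trans sij) ->]; rewrite orbT.
Qed.

Lemma lineE t : line T s t = seq.filter (ahead T s t) order_list.
Proof.
by rewrite /line /order_list filter_sort//;
  [exact: arrival_order_total|exact: arrival_order_trans].
Qed.

Lemma line_take t : exists k, line T s t = take k order_list.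
Proof.
rewrite lineE; eexists; apply: filter_sorted_take sorted_order_list.
  exact: arrival_order_trans.
exact: ahead_mono.
Qed.

Lemma num_arrivedE t : num_arrived T s t = (\sum_i ahead T s t i)%N.
Proof. by rewrite /num_arrived lineE size_filter count_order_list. Qed.

(** The line is a prefix of the full order, so departure times computed in it agree with the global
    ones, and the queue length becomes a sum over customers. *)
Lemma num_presentE t :
  num_present T S s t = (\sum_i (ahead T s t i && (t < departure i)%R))%N.
Proof.
rewrite /num_present /departures -/(serve T S).
have ul : uniq (line T s t) by rewrite lineE filter_uniq ?uniq_order_list.
rewrite (scanl_serve _ _ _ ul).
have -> : [seq service_start T S 0 (line T s t) i + S i | i <- line T s t]
        = [seq departure i | i <- line T s t].
  apply/eq_in_map => i; have [k ->] := line_take t => il.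
  by rewrite (service_start_take _ _ _ il).
rewrite count_map lineE count_filter -count_order_list.
by apply: eq_count => i /=; rewrite andbC.
Qed.

Lemma arrival_le_start i : T i <= start i.
Proof. by rewrite /start /service_start le_max lexx orbT. Qed.

Hypothesis S_gt0 : forall i, 0 < S i.

Lemma arrival_lt_departure i : T i < departure i.
Proof. by rewrite (le_lt_trans (arrival_le_start i))// ltrDl. Qed.

Lemma start_ge0 i : 0 <= start i.
Proof. by apply: service_start_ge => j; exact: ltW. Qed.

Lemma departure_ahead t i : departure i <= t -> ahead T s t i.
Proof. by move=> /(lt_le_trans (arrival_lt_departure i)) it; rewrite /ahead it. Qed.

Lemma sum_in_service u : 0 <= u ->
  (\sum_i (start i <= u < departure i)%R)%N
  = [exists i, T i <= u < departure i].
Proof.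
move=> u0; rewrite -count_order_list.
rewrite (count_in_service S_gt0 u0 uniq_order_list).
  congr (nat_of_bool _); apply/hasP/existsP => [[i _ ?]|[i ?]]; exists i => //.
  exact: mem_order_list.
apply: sub_sorted sorted_order_list => i j.
by rewrite /arrival_order => /orP[/ltW|/andP[/eqP ->]].
Qed.

End Queue.

(** * Exponential service times *)

(** The multiple [*+ (0 <= a)%R] acts as an indicator, so that one formula covers negative [a] and
    can be used under an integral. *)
Lemma exponential_prob_le (R : realType) (mu a : R) :
  exponential_prob mu `]-oo, a] = ((1 - expR (- mu * a)) *+ (0 <= a)%R)%:E.
Proof.
have E : `]-oo, a] `&` `[0, +oo[ = `[0, a]%classic :> set R.
  apply/seteqP; split=> x /=; rewrite !in_itv/= andbT.
    by move=> [-> ->].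
  by move=> /andP[-> ->].
have -> : exponential_prob mu `]-oo, a] = exponential_prob mu `[0, a]%classic.
  rewrite -E /exponential_prob integral_mkcondr.
  apply: eq_integral => x _; rewrite patchE /exponential_pdf patchE.
  by case: ifP.
have [a0|a0] := ltP a 0.
  by rewrite set_itv_ge -?leNgt ?bnd_simp// /exponential_prob integral_set0.
move: a0; rewrite le_eqVlt => /predU1P[<-|a0].
  by rewrite set_itv1 /exponential_prob integral_set1 mulr0 expR0 subrr.
by rewrite exponential_prob_itv0c// EFinB.
Qed.

Lemma integral_expR_shift (R : realType) (mu x t : R) : 0 < mu -> x <= t ->
  (\int[lebesgue_measure]_(u in `[x, t]) (expR (- mu * (u - x)))%:E
   = ((1 - expR (- mu * (t - x))) / mu)%:E)%E.
Proof.
move=> mu0; rewrite le_eqVlt => /predU1P[->|xt].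
  by rewrite set_itv1 integral_set1 subrr mulr0 expR0 subrr mul0r.
have dE (z : R) : is_derive z 1 (fun u : R => - expR (- mu * (u - x)) / mu)
    (expR (- mu * (z - x))).
  apply: is_derive_eq; rewrite /GRing.scale/=.
  by field; rewrite gt_eqF.
rewrite (@continuous_FTC2 _ _ (fun u => - expR (- mu * (u - x)) / mu)) //.
- by rewrite -EFinB subrr mulr0 expR0; congr EFin; field; rewrite gt_eqF.
- apply: continuous_subspaceT => z.
  apply: continuous_comp; last exact: continuous_expR.
  apply: continuousM; first exact: cst_continuous.
  by apply: continuousB => //; exact: cst_continuous.
- have c (z : R) : {for z, continuous (fun u => - expR (- mu * (u - x)) / mu)}.
    by apply: differentiable_continuous; apply/derivable1_diffP; have [] := dE z.
  split.
  + by move=> z _; have [] := dE z.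
  + exact/cvg_at_right_filter/c.
  + exact/cvg_at_left_filter/c.
- by move=> z _; rewrite derive1E; have [_ ->] := dE z.
Qed.

Lemma measurable_set_le d (T : measurableType d) (R : realType) (f g : T -> R) :
  measurable_fun setT f -> measurable_fun setT g ->
  measurable [set x | f x <= g x].
Proof.
move=> mf mg; have m : measurable_fun setT (fun x => g x - f x).
  exact: measurable_funB.
have := m measurableT _ (measurable_itv `[0, +oo[).
rewrite setTI; congr (measurable _); apply/seteqP; split=> x /=.
  by rewrite in_itv/= andbT subr_ge0.
by rewrite in_itv/= andbT subr_ge0.
Qed.

Lemma measurable_set_lt d (T : measurableType d) (R : realType) (f g : T -> R) :
  measurable_fun setT f -> measurable_fun setT g ->
  measurable [set x | f x < g x].
Proof.
move=> mf mg; have -> : [set x | f x < g x] = ~` [set x | g x <= f x].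
  by apply/seteqP; split=> x /=; rewrite ltNge => /negP.
exact/measurableC/measurable_set_le.
Qed.

Section ExponentialService.
Variables (R : realType) (d : measure_display) (Omega : measurableType d).
Variables (P : probability Omega R) (X Y : {RV P >-> R}) (mu : R).
Hypothesis mu_gt0 : 0 < mu.
Hypothesis Y_exp : forall B : set R, measurable B ->
  distribution P Y B = exponential_prob mu B.
Hypothesis XY_indep : forall A B : set R, measurable A -> measurable B ->
  P (X @^-1` A `&` Y @^-1` B) = (P (X @^-1` A) * P (Y @^-1` B))%E.
Hypothesis X_ge0 : P [set w | X w < 0] = 0%E.

Let mX : measurable_fun setT X. Proof. exact: measurable_funPT. Qed.
Let mY : measurable_fun setT Y. Proof. exact: measurable_funPT. Qed.

(** By independence the joint law agrees with the product measure on rectangles, hence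
    everywhere. *)
Lemma joint_probability (E : set (R * R)) : measurable E ->
  P [set w | E (X w, Y w)] =
  (\int[distribution P X]_x distribution P Y (xsection E x))%E.
Proof.
move=> mE; pose Z w := (X w, Y w).
have mZ : measurable_fun setT Z by exact: measurable_fun_pair.
have joint (A B : set R) : measurable A -> measurable B ->
    distribution P (mfun_Sub (mem_set mZ)) (A `*` B) =
    (distribution P X A * distribution P Y B)%E.
  by move=> mA mB; rewrite -[RHS]XY_indep.
exact: esym (product_measure_unique joint mE).
Qed.

Lemma distribution_exp_gt a : 0 <= a ->
  distribution P Y `]a, +oo[ = (expR (- mu * a))%:E.
Proof.
move=> a0; rewrite -setCitvl probability_setC//.
rewrite [X in (1 - X)%E](Y_exp (measurable_itv _)) exponential_prob_le a0.
by rewrite mulr1n EFinB oppeB// addeA subee// add0e.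
Qed.

Lemma in_service_probability u :
  P [set w | X w <= u < X w + Y w] =
  (\int[distribution P X]_x (expR (- mu * (u - x)) *+ (x <= u)%R)%:E)%E.
Proof.
have mE : measurable [set z : R * R | z.1 <= u /\ u < z.1 + z.2].
  apply: measurableI; first exact: measurable_set_le.
  by apply: measurable_set_lt => //; exact: measurable_funD.
rewrite (_ : [set _ | _] = [set w | [set z : R * R | z.1 <= u /\ u < z.1 + z.2] (X w, Y w)]).
  rewrite joint_probability//; apply: eq_integral => x _.
  have [xu|ux] := leP x u.
    rewrite -distribution_exp_gt ?subr_ge0//; congr (distribution P Y _).
    apply/seteqP; split=> y /=; rewrite /xsection/= in_itv/= andbT inE/= ltrBlDl.
      by move=> [].
    by [].
  rewrite (_ : xsection _ _ = set0) ?measure0//.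
  apply/seteqP; split=> y //=; rewrite /xsection/= inE/= leNgt ux.
  by move=> [].
by apply/seteqP; split=> w /= => /andP.
Qed.

Lemma completion_probability t :
  P [set w | X w + Y w <= t] =
  (\int[distribution P X]_x ((1 - expR (- mu * (t - x))) *+ (x <= t)%R)%:E)%E.
Proof.
have mE : measurable [set z : R * R | z.1 + z.2 <= t].
  by apply: measurable_set_le => //; exact: measurable_funD.
rewrite (joint_probability mE); apply: eq_integral => x _.
rewrite -[(x <= t)%R]subr_ge0 -exponential_prob_le -Y_exp//.
congr (distribution P Y _); apply/seteqP.
by split=> y /=; rewrite /xsection/= in_itv/= inE/= lerBrDl.
Qed.

Let measurable_occupation (t : R) : measurable_fun setT (fun z : R * R =>
  (expR (- mu * (z.2 - z.1)) * \1_[set z : R * R | z.1 <= z.2 /\ 0 <= z.2 <= t] z)%:E).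
Proof.
apply/measurable_EFinP; apply: measurable_funM.
  apply: measurableT_comp; first exact: measurable_expR.
  by apply: measurable_funM => //; exact: measurable_funB.
apply: measurable_indic; apply: measurableI; first exact: measurable_set_le.
rewrite [X in measurable X](_ : _ = [set z : R * R | 0 <= z.2] `&` [set z | z.2 <= t]).
  by apply: measurableI; exact: measurable_set_le.
by apply/seteqP; split=> z /= => /andP.
Qed.

(** The exponential law has constant hazard rate [mu]: for a start fixed at [x] in [[0, t]] both
    sides equal [1 - expR (- mu * (t - x))], the right one as [mu] times an integral of the survival
    function from [x] to [t]. *)
Lemma expected_occupation t :
  P [set w | X w + Y w <= t] =
  (mu%:E * \int[lebesgue_measure]_(u in `[0%R, t]) P [set w | (X w <= u < X w + Y w)%R])%E.
Proof.
pose f (z : R * R) := (expR (- mu * (z.2 - z.1)) *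
  \1_[set z : R * R | z.1 <= z.2 /\ 0 <= z.2 <= t] z)%:E.
have mf : measurable_fun setT f := measurable_occupation t.
have f0 z : (0 <= f z)%E by rewrite lee_fin mulr_ge0 ?expR_ge0.
rewrite integral_mkcond.
have -> : (\int[lebesgue_measure]_u
    ((fun u => P [set w | (X w <= u < X w + Y w)%R]) \_ `[0%R, t]) u
  = \int[lebesgue_measure]_u \int[distribution P X]_x f (x, u))%E.
  apply: eq_integral => u _; rewrite patchE mem_setE in_itv/=; case: ifPn => u0t.
    rewrite in_service_probability; apply: eq_integral => x _.
    rewrite /f /= indicE; congr EFin; case: (leP x u) => xu.
      by rewrite mem_set ?mulr1.
    by rewrite memNset ?mulr0//= => -[]; rewrite leNgt xu.
  rewrite integral0_eq// => x _; rewrite /f indicE memNset ?mulr0//= => -[_].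
  exact/negP.
rewrite -(@fubini_tonelli _ _ _ _ _ (distribution P X) lebesgue_measure _ mf f0).
have mI : measurable_fun setT (fun x => \int[lebesgue_measure]_u f (x, u))%E.
  exact: (@measurable_fun_fubini_tonelli_F _ _ _ _ _ lebesgue_measure _ mf f0).
have I0 x : setT x -> (0 <= \int[lebesgue_measure]_u f (x, u))%E.
  by move=> _; exact: integral_ge0.
rewrite -(ge0_integralZl _ measurableT mI I0) ?lee_fin ?ltW//.
rewrite completion_probability; apply: ae_eq_integral => //.
- apply/measurable_EFinP.
  rewrite (_ : (fun _ => _) = fun x => (1 - expR (- mu * (t - x))) * \1_[set x | x <= t] x).
    apply: measurable_funM.
      apply: measurable_funB => //; apply: measurableT_comp; first exact: measurable_expR.
      by apply: measurable_funM => //; exact: measurable_funB.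
    by apply: measurable_indic; exact: measurable_set_le.
  apply/funext => x; rewrite indicE; case: leP => xt.
    by rewrite mem_set// mulr1.
  by rewrite memNset ?mulr0//= leNgt xt.
- exact: measurable_funeM.
(* The integral starts at [0], so the integrands may differ for negative [x], a null set for the law
   of [X]. *)
- exists [set x | x < 0]; split => //=.
    by apply: measurable_set_lt.
  move=> x /= /not_implyP[_]; apply: contra_notP => /negP; rewrite -leNgt => x0.
  rewrite [X in (_ * X)%E](_ : _ = (
    \int[lebesgue_measure]_(u in `[x, t]) (expR (- mu * (u - x)))%:E)%E); last first.
    rewrite [RHS]integral_mkcond; apply: eq_integral => u _.
    rewrite /f patchE mem_setE in_itv/= indicE; case: ifPn => xut.
      move/andP: xut => [xu ut]; rewrite mem_set ?mulr1//=.
      by rewrite xu ut (le_trans x0).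
    rewrite memNset ?mulr0//= => -[xu /andP[_ ut]]; case/negP: xut.
    by rewrite xu.
  have [xt|tx] := leP x t.
    by rewrite integral_expR_shift// -EFinM; congr EFin;
      rewrite mulr1n mulrCA divff ?mulr1 ?gt_eqF.
  by rewrite set_itv_ge -?leNgt ?bnd_simp// integral_set0 mule0.
Qed.

End ExponentialService.

(** * Measurability and independence *)

(** Tie-breaking orders and tables of comparisons take finitely many values, so dependence on them
    is treated one value at a time. *)
Lemma measurable_fibers d (T : measurableType d) (I : finType) (X : T -> I) :
  (forall x, measurable [set w | X w = x]) ->
  forall E : I -> set T, (forall x, measurable (E x)) ->
  measurable [set w | E (X w) w].
Proof.
move=> mX E mE.
rewrite (_ : [set w | _] = \bigcup_(x in [set: I]) ([set w | X w = x] `&` E x)).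
  apply: fin_bigcup_measurable => // x _; exact: measurableI.
by apply/seteqP; split=> w /= => [|[x _ [<-]]]//; exists (X w).
Qed.

Section MeasurableQueue.
Variables (R : realType) (d : measure_display) (Omega : measurableType d).
Variables (N : nat) (T S : 'I_N -> Omega -> R) (s : Omega -> {perm 'I_N.+1}).
Hypothesis mT : forall i, measurable_fun setT (T i).
Hypothesis ms : forall p, measurable [set w | s w = p].

Lemma measurable_tie_pred (Q : pred {perm 'I_N.+1}) : measurable [set w | Q (s w)].
Proof.
apply: (@measurable_fibers _ _ _ s ms (fun p => [set _ | Q p])) => p.
have [Qp|Qp] := boolP (Q p).
  by rewrite (_ : mkset _ = setT)//; apply/seteqP; split.
by rewrite (_ : mkset _ = set0)//; apply/seteqP; split=> // w /=; apply/negP.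
Qed.

Lemma measurable_set_eq (f g : Omega -> R) :
  measurable_fun setT f -> measurable_fun setT g ->
  measurable [set w | f w = g w].
Proof.
move=> mf mg.
rewrite (_ : mkset _ = [set w | f w <= g w] `&` [set w | g w <= f w]).
  by apply: measurableI; exact: measurable_set_le.
apply/seteqP; split=> w /= => [->//|[fg gf]].
by apply/eqP; rewrite eq_le fg.
Qed.

Lemma measurable_before (f g : Omega -> R) (Q : pred {perm 'I_N.+1}) :
  measurable_fun setT f -> measurable_fun setT g ->
  measurable [set w | (f w < g w) || (f w == g w) && Q (s w)].
Proof.
move=> mf mg.
rewrite (_ : mkset _ = [set w | f w < g w] `|`
  ([set w | f w = g w] `&` [set w | Q (s w)])).
  apply: measurableU; first exact: measurable_set_lt.
  by apply: measurableI; [exact: measurable_set_eq|exact: measurable_tie_pred].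
apply/seteqP; split=> w /=.
  by move=> /orP[?|/andP[/eqP ? ?]]; [left|right].
by move=> [->//|[-> ->]]; rewrite eqxx orbT.
Qed.

Lemma measurable_ahead t i : measurable [set w | ahead (T^~ w) (s w) t i].
Proof.
by apply: (@measurable_before (T i) (fun=> t)
  (fun p => (p (lift ord0 i) < p ord0)%N)).
Qed.

Lemma measurable_arrival_order i j :
  measurable [set w | arrival_order (T^~ w) (s w) i j].
Proof.
exact: (@measurable_before (T i) (T j)
  (fun p => (p (lift ord0 i) <= p (lift ord0 j))%N)).
Qed.

Lemma measurable_foldl_serve (l : seq 'I_N) (a : Omega -> R) :
  measurable_fun setT a -> (forall j, j \in l -> measurable_fun setT (S j)) ->
  measurable_fun setT (fun w => foldl (serve (T^~ w) (S^~ w)) (a w) l).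
Proof.
elim: l a => //= j l IHl a ma mS; apply: (IHl (fun w => serve (T^~ w) (S^~ w) (a w) j)).
  apply: measurable_funD; last by apply: mS; rewrite mem_head.
  exact: measurable_maxr.
by move=> k kl; apply: mS; rewrite in_cons kl orbT.
Qed.

(** The service time of [i] itself is absent from the hypothesis. This allows the sigma-algebra
    generated by all the other data, from which independence follows. *)
Lemma measurable_start i : (forall j, j != i -> measurable_fun setT (S j)) ->
  measurable_fun setT (fun w => start (T^~ w) (S^~ w) (s w) i).
Proof.
move=> mS.
(* The sorted list depends on [w] only through the finite table of pairwise comparisons; on each
   fibre of [rel_of] it is constant. *)
pose rel_of w := [ffun p : 'I_N * 'I_N => arrival_order (T^~ w) (s w) p.1 p.2].
pose list_of (e : {ffun 'I_N * 'I_N -> bool}) :=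
  sort (fun j k => e (j, k)) (enum 'I_N).
pose start_of e w := service_start (T^~ w) (S^~ w) 0 (list_of e) i.
have mrel e : measurable [set w | rel_of w = e].
  rewrite (_ : mkset _ = \bigcap_(p in [set: 'I_N * 'I_N])
      [set w | arrival_order (T^~ w) (s w) p.1 p.2 = e p]).
    apply: fin_bigcap_measurable => // p _.
    case: (e p); first exact: measurable_arrival_order.
    rewrite (_ : mkset _ = ~` [set w | arrival_order (T^~ w) (s w) p.1 p.2]).
      exact/measurableC/measurable_arrival_order.
    by apply/seteqP; split=> w /= => [->|/negP/negPf].
  apply/seteqP; split=> w /= => [<- p _|h]; first by rewrite ffunE.
  by apply/ffunP => p; rewrite ffunE h.
have mstart e : measurable_fun setT (start_of e).
  apply: measurable_maxr => //; apply: measurable_foldl_serve => // j jl.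
  (* [i] does not occur among the entries before its own index. *)
  by apply: mS; apply: contraTneq jl => ->; apply/negP => /index_ltn; rewrite ltnn.
have startE w : start (T^~ w) (S^~ w) (s w) i = start_of (rel_of w) w.
  rewrite /start /start_of /list_of /order_list; congr service_start.
  by congr sort; apply/funext => j; apply/funext => k; rewrite ffunE.
move=> _ B mB; rewrite setTI.
rewrite (_ : _ @^-1` _ = [set w | (start_of (rel_of w) @^-1` B) w]).
  apply: (@measurable_fibers _ _ _ rel_of mrel (fun e => start_of e @^-1` B)) => e.
  by rewrite -[X in measurable X]setTI; exact: mstart.
by apply/seteqP; split=> w /=; rewrite startE.
Qed.

End MeasurableQueue.

Section Independence.
Variables (R : realType) (N : nat) (mu : R) (F : cumulativeBounded (0 : R) (1 : R)).
Variables (d : measure_display) (Omega : measurableType d).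
Variables (P : probability Omega R) (M : queue_model N mu F P).

Definition start_time (i : 'I_N) (w : Omega) : R :=
  start (fun j => arrival M j w) (fun j => service M j w) (tie M w) i.

Let box (A B : 'I_N -> set R) (s : {perm 'I_N.+1}) : set Omega :=
  [set w | [/\ forall i, A i (arrival M i w), forall i, B i (service M i w)
             & tie M w = s]].

Let mtie s : measurable [set w | tie M w = s].
Proof. exact: (measurable_tie M s). Qed.

Let marr i : measurable_fun setT (arrival M i).
Proof. exact: measurable_funPT. Qed.

Let mserv i : measurable_fun setT (service M i).
Proof. exact: measurable_funPT. Qed.

Let measurable_box A B s : (forall i, measurable (A i)) ->
  (forall i, measurable (B i)) -> measurable (box A B s).
Proof.
move=> mA mB.
rewrite (_ : box A B s = (\bigcap_(i in [set: 'I_N]) (arrival M i @^-1` A i)) `&`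
  (\bigcap_(i in [set: 'I_N]) (service M i @^-1` B i)) `&` [set w | tie M w = s]).
  apply: measurableI => //; apply: measurableI; apply: fin_bigcap_measurable => // i _.
    by rewrite -[X in measurable X]setTI; exact: marr.
  by rewrite -[X in measurable X]setTI; exact: mserv.
apply/seteqP; split=> w /=.
  by move=> [hA hB hs]; split => //; split=> i _; [exact: hA|exact: hB].
by move=> [[hA hB] hs]; split => // i; [exact: hA|exact: hB].
Qed.

(* A pi-system of events not involving the service time of [i]; [set0] arises
   from intersecting events with different tie-breaking orders. *)
Let boxes (i : 'I_N) : set (set Omega) := [set E | E = set0 \/
  exists A B s, [/\ forall j, measurable (A j), forall j, measurable (B j),
                    B i = setT & E = box A B s]].

Let boxes_measurable i : boxes i `<=` measurable.
Proof. by move=> E [->|[A [B [s [mA mB _ ->]]]]]//; exact: measurable_box. Qed.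

Let boxesI i : setI_closed (boxes i).
Proof.
move=> E E' [->|[A [B [s [mA mB BT ->]]]]]; first by rewrite set0I; left.
move=> [->|[A' [B' [s' [mA' mB' BT' ->]]]]]; first by rewrite setI0; left.
have [<-|ss'] := eqVneq s s'; last first.
  left; apply/seteqP; split => // w [[_ _ h] [_ _ h']] /=.
  by case/eqP: ss'; rewrite -h -h'.
right; exists (fun j => A j `&` A' j), (fun j => B j `&` B' j), s; split.
- by move=> j; exact: measurableI.
- by move=> j; exact: measurableI.
- by rewrite BT BT' setTI.
- apply/seteqP; split=> w /=.
    by move=> [[hA hB hs] [hA' hB' _]]; split => // j; split.
  move=> [hA hB hs]; split; split => // j.
  + by have [] := hA j.
  + by have [] := hB j.
  + by have [] := hA j.
  + by have [] := hB j.
Qed.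

Let boxes_independent i (C : set R) E : measurable C -> boxes i E ->
  P (E `&` service M i @^-1` C) = (P (service M i @^-1` C) * P E)%E.
Proof.
move=> mC [->|[A [B [s [mA mB BT ->]]]]]; first by rewrite set0I measure0 mule0.
(* The slot of [i] is unconstrained in the box, so the condition [C] can be put there, and the
   intersection is again a box. *)
pose B' j := if j == i then C else B j.
have mB' j : measurable (B' j) by rewrite /B'; case: ifP.
rewrite (_ : _ `&` _ = box A B' s).
  rewrite [LHS](independent M s mA mB') [in RHS](independent M s mA mB).
  rewrite [X in (_ * X * _)%E = _](bigD1 i)//=.
  rewrite [X in _ = (_ * (_ * X * _))%E](bigD1 i)//=.
  rewrite BT preimage_setT probability_setT mul1e.
  have -> : (\prod_(j < N | j != i) P (service M j @^-1` B' j) =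
      \prod_(j < N | j != i) P (service M j @^-1` B j))%E.
    by apply: eq_bigr => j ji; rewrite /B' (negPf ji).
  by rewrite {1}/B' eqxx muleCA !muleA.
apply/seteqP; split=> w /=.
  move=> [[hA hB hs] hC]; split=> // j.
  by rewrite /B'; case: eqP => [->//|_]; exact: hB.
move=> [hA hB hs]; split; last by have := hB i; rewrite /B' eqxx.
split=> // j; have := hB j; rewrite /B'; case: eqP => [->|//].
by rewrite BT.
Qed.

(** A box fixes the tie-breaking order; the union over all orders yields events about arrivals and
    services alone. *)
Let box_union_measurable i A B :
  (forall j, measurable (A j)) -> (forall j, measurable (B j)) -> B i = setT ->
  measurable ([set w | (forall j, A j (arrival M j w)) /\
     (forall j, B j (service M j w))] : set (g_sigma_algebraType (boxes i))).
Proof.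
move=> mA mB BT.
rewrite (_ : mkset _ = \bigcup_(s in [set: {perm 'I_N.+1}]) box A B s).
  apply: (@fin_bigcup_measurable _ (g_sigma_algebraType (boxes i))) => [|s _].
    exact: finite_finset.
  by apply: sub_sigma_algebra; right; exists A, B, s; split.
by apply/seteqP; split=> w /= => [[hA hB]|[s _ [hA hB _]]]//; exists (tie M w).
Qed.

(** For fixed [C], both sides are finite measures of the event about the start time. They agree on
    the pi-system [boxes i], hence on the sigma-algebra it generates. *)
Lemma start_service_independent i (A C : set R) : measurable A -> measurable C ->
  P (start_time i @^-1` A `&` service M i @^-1` C) =
  (P (start_time i @^-1` A) * P (service M i @^-1` C))%E.
Proof.
move=> mA mC.
have mSC : measurable (service M i @^-1` C).
  by rewrite -[X in measurable X]setTI; exact: mserv.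
have p0 : 0 <= fine (P (service M i @^-1` C)) by exact: fine_ge0.
have pE : (fine (P (service M i @^-1` C)))%:E = P (service M i @^-1` C).
  by rewrite fineK// fin_num_measure.
pose m1 := mrestr P mSC.
pose m2 := mscale (NngNum p0) P.
(* A countable cover by sets of the pi-system, as required by uniqueness of measures; past the end
   of the enumeration the default [1%g] merely repeats a set. *)
pose g n := [set w | tie M w = nth 1%g (enum {perm 'I_N.+1}) n].
rewrite muleC.
have m2E E : m2 E = (P (service M i @^-1` C) * P E)%E by rewrite /m2 /mscale/= pE.
rewrite -m2E -[LHS]/(m1 _).
apply: (@g_sigma_algebra_measure_unique _ _ _ (boxes i) (@boxes_measurable i) g).
- move=> n; right; exists (fun=> setT), (fun=> setT), (nth 1%g (enum {perm 'I_N.+1}) n).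
  by split=> //; apply/seteqP; split=> w /= => [|[]].
- apply/seteqP; split=> // w _; exists (index (tie M w) (enum {perm 'I_N.+1})) => //=.
  by rewrite /g/= nth_index// mem_enum.
- exact: boxesI.
- by move=> E /(boxes_independent mC) h; exact: etrans h (esym (m2E E)).
- move=> k; apply: (@le_lt_trans _ _ 1%E); last exact: ltry.
  by apply: probability_le1; apply: measurableI => //; exact: mtie.
have mt p : measurable ([set w | tie M w = p] : set (g_sigma_algebraType (boxes i))).
  apply: sub_sigma_algebra; right; exists (fun=> setT), (fun=> setT), p; split=> //.
  by apply/seteqP; split=> w /= => [|[]].
(* It remains to place the event about the start time in the generated sigma-algebra: arrivals, ties
   and the services of the others are measurable there. *)
rewrite -[X in <<s _ >> X]setTI.
apply: (@measurable_start _ _ (g_sigma_algebraType (boxes i)) _ (fun j => arrival M j)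
  (fun j => service M j) _ _ mt i _ measurableT _ mA).
- move=> j _ B mB; rewrite setTI.
  have := @box_union_measurable i (fun k => if k == j then B else setT) (fun=> setT).
  rewrite (_ : mkset _ = arrival M j @^-1` B); first by apply => // k; case: ifP.
  apply/seteqP; split=> w /= => [[/(_ j)]|Bw]; first by rewrite eqxx.
  by split=> // k; case: eqP => // ->.
- move=> j ji _ B mB; rewrite setTI.
  have := @box_union_measurable i (fun=> setT) (fun k => if k == j then B else setT).
  rewrite (_ : mkset _ = service M j @^-1` B).
    apply => //; first by move=> k; case: ifP.
    by rewrite eq_sym (negPf ji).
  apply/seteqP; split=> w /= => [[_ /(_ j)]|Bw]; first by rewrite eqxx.
  by split=> // k; case: eqP => // ->.
Qed.

End Independence.

(** * Departures in expectation *)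

Section RealProbability.
Variables (R : realType) (d : measure_display) (Omega : measurableType d).
Variables (P : probability Omega R).
Implicit Types A B C G : set Omega.

Definition pr A : R := fine (P A).

Lemma prE A : measurable A -> (pr A)%:E = P A.
Proof. by move=> mA; rewrite /pr fineK// fin_num_measure. Qed.

Lemma pr_ge0 A : 0 <= pr A.
Proof. exact: fine_ge0. Qed.

Lemma pr_le1 A : measurable A -> pr A <= 1.
Proof. by move=> mA; rewrite -lee_fin prE// probability_le1. Qed.

Lemma pr0 : pr set0 = 0.
Proof. by rewrite /pr measure0. Qed.

Lemma prC A : measurable A -> pr (~` A) = 1 - pr A.
Proof.
move=> mA; apply: EFin_inj; rewrite EFinB !prE//; last exact: measurableC.
exact: probability_setC.
Qed.

Lemma pr_split A B : measurable A -> measurable B ->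
  pr A = pr (A `&` B) + pr (A `\` B).
Proof.
move=> mA mB; apply: EFin_inj; rewrite EFinD !prE//.
- by rewrite addeC; exact: measureDI.
- exact: measurableD.
- exact: measurableI.
Qed.

Lemma pr_mono A B : measurable A -> measurable B -> A `<=` B -> pr A <= pr B.
Proof. by move=> mA mB AB; rewrite -lee_fin !prE// le_measure// inE. Qed.

Lemma pr_leU A B C : measurable A -> measurable B -> measurable C ->
  A `<=` B `|` C -> pr A <= pr B + pr C.
Proof.
move=> mA mB mC ABC; rewrite -lee_fin EFinD !prE//.
apply: le_trans (measureU2 P mB mC).
by rewrite le_measure// inE//; exact: measurableU.
Qed.

Section AlmostSure.
Variable G : set Omega.
Hypotheses (mG : measurable G) (prG : pr G = 1).

Lemma pr_as_le A B : measurable A -> measurable B ->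
  (forall w, G w -> A w -> B w) -> pr A <= pr B.
Proof.
move=> mA mB AB; rewrite -[leRHS]addr0 -(subrr 1) -[X in _ - X]prG -prC//.
apply: pr_leU => //; first exact: measurableC.
by move=> w Aw; have [Gw|Gw] := pselect (G w); [left; exact: AB|right].
Qed.

Lemma pr_as_eq A B : measurable A -> measurable B ->
  (forall w, G w -> (A w <-> B w)) -> pr A = pr B.
Proof.
move=> mA mB AB; apply/eqP; rewrite eq_le.
by apply/andP; split; apply: pr_as_le => // w Gw; have [] := AB w Gw.
Qed.

Lemma pr_as_leU A B C : measurable A -> measurable B -> measurable C ->
  (forall w, G w -> A w -> B w \/ C w) -> pr A <= pr B + pr C.
Proof.
move=> mA mB mC AB; have mAG : measurable (A `&` G) by exact: measurableI.
rewrite (@pr_as_eq A (A `&` G))//; last by move=> w Gw; split=> [|[]].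
by apply: pr_leU => // w [Aw Gw]; exact: AB.
Qed.

Lemma sum_pr (N : nat) (b : 'I_N -> Omega -> bool) (c : Omega -> bool) :
  (forall i, measurable [set w | b i w]) -> measurable [set w | c w] ->
  (forall w, G w -> (\sum_i b i w)%N = c w) ->
  \sum_i pr [set w | b i w] = pr [set w | c w].
Proof.
move=> mb mc bc; apply: EFin_inj; rewrite -sumEFin prE//.
under eq_bigr do rewrite prE// -[X in P X]setIT -integral_indic//.
rewrite -[X in P X]setIT -integral_indic// -ge0_integral_sum//; last first.
  by move=> i; apply/measurable_EFinP; exact: measurable_indic.
apply: ae_eq_integral => //.
- by apply: emeasurable_sum => i; apply/measurable_EFinP; exact: measurable_indic.
- by apply/measurable_EFinP; exact: measurable_indic.
exists (~` G); split; first exact: measurableC.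
  by have := prE (measurableC mG); rewrite prC// prG subrr => /esym.
move=> w /=; apply: contra_not => Gw _.
rewrite sumEFin; congr EFin; rewrite indicE.
have -> : w \in [set w | c w] = c w by apply/idP/idP; rewrite inE.
rewrite -bc// natr_sum; apply: eq_bigr => i _; rewrite indicE; congr (nat_of_bool _)%:R.
by apply/idP/idP; rewrite inE.
Qed.

End AlmostSure.

Lemma pr_exists_le (N : nat) (b : 'I_N -> Omega -> bool) :
  (forall i, measurable [set w | b i w]) ->
  pr [set w | [exists i, b i w]] <= \sum_i pr [set w | b i w].
Proof.
move=> mb.
pose B (s : seq 'I_N) := [set w | has (fun i => b i w) s].
have mB s : measurable (B s).
  elim: s => [|i s IHs]; first by rewrite /B (_ : mkset _ = set0)// -subset0.
  rewrite (_ : B _ = [set w | b i w] `|` B s); first exact: measurableU.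
  by apply/seteqP; split=> w /= => /orP.
have leB s : pr (B s) <= \sum_(i <- s) pr [set w | b i w].
  elim: s => [|i s IHs].
    by rewrite big_nil /B (_ : mkset _ = set0) ?pr0// -subset0.
  rewrite big_cons; apply: le_trans (lerD (lexx _) IHs).
  by apply: pr_leU => // w /= /orP.
have := leB (index_enum 'I_N); rewrite (_ : B _ = [set w | [exists i, b i w]])//.
apply/seteqP; split=> w /=.
  by move=> /hasP[i _ bi]; apply/existsP; exists i.
by move=> /existsP[i bi]; apply/hasP; exists i => //; rewrite mem_index_enum.
Qed.

Lemma expectation_count (N : nat) (b : 'I_N -> Omega -> bool) :
  (forall i, measurable [set w | b i w]) ->
  fine 'E_P[fun w => (\sum_i b i w)%N%:R] = \sum_i pr [set w | b i w].
Proof.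
move=> mb.
have intE i : (\int[P]_w (\1_[set w | b i w] w)%:E)%E = (pr [set w | b i w])%:E.
  by rewrite prE// integral_indic// setIT.
rewrite unlock.
have -> : (\int[P]_w (\sum_i b i w)%N%:R%:E =
    \int[P]_w \sum_i (\1_[set w | b i w] w)%:E)%E.
  apply: eq_integral => w _; rewrite sumEFin natr_sum; congr EFin.
  apply: eq_bigr => i _; rewrite indicE; congr (nat_of_bool _)%:R.
  by apply/idP/idP; rewrite inE.
rewrite ge0_integral_sum//; last first.
  by move=> i; apply/measurable_EFinP; exact: measurable_indic.
by under eq_bigr do rewrite intE; rewrite sumEFin.
Qed.

End RealProbability.

(** * Expected departures and the busy server *)

Section ModelFacts.
Variables (R : realType) (N : nat) (mu : R) (F : cumulativeBounded (0 : R) (1 : R)).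
Variables (d : measure_display) (Omega : measurableType d).
Variables (P : probability Omega R) (M : queue_model N mu F P).
Hypothesis mu_gt0 : 0 < mu.

Local Notation T i w := (arrival M i w).
Local Notation S i w := (service M i w).
Local Notation pr := (pr P).

Definition departure_time (i : 'I_N) (w : Omega) : R := start_time M i w + S i w.

Definition ahead_of (t : R) (i : 'I_N) (w : Omega) : bool :=
  ahead (fun j => T j w) (tie M w) t i.

(** The sample-path identities hold on this event of probability one, and are transferred to
    probabilities by the almost sure comparisons above. *)
Definition positive_service : set Omega := [set w | forall i, 0 < S i w].

Let mT i : measurable_fun setT (arrival M i). Proof. exact: measurable_funPT. Qed.
Let mS i : measurable_fun setT (service M i). Proof. exact: measurable_funPT. Qed.
Let mtie s : measurable [set w | tie M w = s]. Proof. exact: (measurable_tie M s). Qed.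

Let mstart i : measurable_fun setT (start_time M i).
Proof. exact: (measurable_start (T := arrival M) (S := service M)). Qed.

Lemma measurable_departure_time i : measurable_fun setT (departure_time i).
Proof. exact: measurable_funD. Qed.
Let mdep := measurable_departure_time.

Lemma measurable_ahead_of t i : measurable [set w | ahead_of t i w].
Proof. exact: (measurable_ahead (T := arrival M)). Qed.

Lemma measurable_departed t i : measurable [set w | departure_time i w <= t].
Proof. exact: measurable_set_le. Qed.

Lemma measurable_in_service u i :
  measurable [set w | start_time M i w <= u < departure_time i w].
Proof.
rewrite (_ : mkset _ = [set w | start_time M i w <= u] `&` [set w | u < departure_time i w]).
  by apply: measurableI; [exact: measurable_set_le|exact: measurable_set_lt].
by apply/seteqP; split=> w /= => /andP.
Qed.

Lemma measurable_exists (b : 'I_N -> Omega -> bool) :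
  (forall i, measurable [set w | b i w]) -> measurable [set w | [exists i, b i w]].
Proof.
move=> mb; rewrite (_ : mkset _ = \bigcup_(i in [set: 'I_N]) [set w | b i w]).
  exact: fin_bigcup_measurable.
by apply/seteqP; split=> w /= => [/existsP[i bi]|[i _ bi]];
  [exists i|apply/existsP; exists i].
Qed.

Lemma measurable_andb (b c : Omega -> bool) : measurable [set w | b w] ->
  measurable [set w | c w] -> measurable [set w | b w && c w].
Proof.
move=> mb mc; rewrite (_ : mkset _ = [set w | b w] `&` [set w | c w]).
  exact: measurableI.
by apply/seteqP; split=> w /= => /andP.
Qed.

Lemma measurable_present t i :
  measurable [set w | ahead_of t i w && (t < departure_time i w)].
Proof.
by apply: measurable_andb; [exact: measurable_ahead_of|exact: measurable_set_lt].
Qed.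

Lemma pr_service_le0 i : pr [set w | S i w <= 0] = 0.
Proof.
have := service_exponential M i (measurable_itv `]-oo, 0]).
rewrite exponential_prob_le lexx mulr0 expR0 subrr mul0rn /distribution /pushforward => h.
by rewrite /pr (_ : mkset _ = service M i @^-1` `]-oo, 0]) ?h.
Qed.

Lemma measurable_positive_service : measurable positive_service.
Proof.
rewrite (_ : positive_service = \bigcap_(i in [set: 'I_N]) [set w | 0 < S i w]).
  by apply: fin_bigcap_measurable => // i _; exact: measurable_set_lt.
by apply/seteqP; split=> w /= h i; [move=> _; exact: h|exact: h].
Qed.

Lemma pr_positive_service : pr positive_service = 1.
Proof.
have mb i : measurable [set w | S i w <= 0] by exact: measurable_set_le.
have mC := measurableC measurable_positive_service.
suff : pr (~` positive_service) <= 0.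
  rewrite prC; last exact: measurable_positive_service.
  have := pr_le1 P measurable_positive_service; lra.
have <- : \sum_(i < N) pr [set w | S i w <= 0] = 0.
  by rewrite big1// => i _; exact: pr_service_le0.
apply: le_trans (pr_exists_le _ mb); apply: pr_mono => //.
  exact: measurable_exists.
move=> w /= /existsNP[i /negP]; rewrite -leNgt => h.
by apply/existsP; exists i.
Qed.

Let mG := measurable_positive_service.
Let prG := pr_positive_service.

Lemma departed_probability i t : P [set w | departure_time i w <= t] =
  (mu%:E * \int[lebesgue_measure]_(u in `[0%R, t])
    P [set w | (start_time M i w <= u < departure_time i w)%R])%E.
Proof.
pose X : {RV P >-> R} := mfun_Sub (mem_set (mstart i)).
apply: (@expected_occupation _ _ _ P X (service M i) mu) => //.
- by move=> B mB; exact: service_exponential.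
- by move=> A B mA mB; exact: start_service_independent.
have mX : measurable [set w | X w < 0] by exact: measurable_set_lt.
rewrite -prE//; congr EFin; rewrite -[RHS](pr0 P).
apply: (pr_as_eq mG prG) => // w Gw; split=> //=.
by rewrite ltNge (start_ge0 _ _ Gw).
Qed.

Definition departed (t : R) : R := \sum_(i < N) pr [set w | departure_time i w <= t].

(** A customer arriving exactly at [u] counts whatever the tie-breaking, as in [sum_in_service]; the
    cost instead involves those ahead. [pr_busy] reconciles the two. *)
Definition busy (u : R) : set Omega := [set w | [exists i, T i w <= u < departure_time i w]].

Lemma measurable_busy u : measurable (busy u).
Proof.
apply: measurable_exists => i; apply: measurable_andb.
  exact: measurable_set_le.
exact: measurable_set_lt.
Qed.

Lemma sum_pr_in_service u : 0 <= u ->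
  \sum_(i < N) pr [set w | start_time M i w <= u < departure_time i w] = pr (busy u).
Proof.
move=> u0; apply: (sum_pr mG prG).
- by move=> i; exact: measurable_in_service.
- exact: measurable_busy.
- by move=> w Gw; exact: sum_in_service.
Qed.

Let measurable_pr_in_service i : measurable_fun setT
  (fun u => P [set w | start_time M i w <= u < departure_time i w]).
Proof.
pose E := [set z : Omega * R | start_time M i z.1 <= z.2 < departure_time i z.1].
have mE : measurable E.
  rewrite /E (_ : mkset _ = [set z : Omega * R | start_time M i z.1 <= z.2]
    `&` [set z | z.2 < departure_time i z.1]).
    apply: measurableI; [apply: measurable_set_le|apply: measurable_set_lt] => //.
      by apply: (measurableT_comp (mstart i)).
    by apply: (measurableT_comp (mdep i)).
  by apply/seteqP; split=> w /= => /andP.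
apply: (eq_measurable_fun (P \o ysection E)).
  move=> u _ /=; congr (P _); apply/seteqP.
  by split=> w /=; rewrite /ysection /= inE.
exact: measurable_fun_ysection.
Qed.

(** Before [0] customers may wait with nobody in service, so the identity with in-service
    probabilities, from which measurability is read off, is confined to nonnegative times. *)
Lemma measurable_pr_busy : measurable_fun (`[0, +oo[%classic : set R) (fun u => P (busy u)).
Proof.
pose f u := (\sum_(i < N)
  P [set w | (start_time M i w <= u < departure_time i w)%R])%E.
apply: (@eq_measurable_fun _ _ _ _ _ f).
  move=> u; rewrite inE/= in_itv/= andbT => u0.
  rewrite /f -(prE P (measurable_busy u)) -sum_pr_in_service// -sumEFin.
  by apply: eq_bigr => i _; rewrite prE//; exact: measurable_in_service.
apply: measurable_funTS; apply: emeasurable_sum => i.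
exact: measurable_pr_in_service.
Qed.

Lemma departedE t : (departed t)%:E =
  (mu%:E * \int[lebesgue_measure]_(u in `[0%R, t]) P (busy u))%E.
Proof.
rewrite /departed -sumEFin.
under eq_bigr do rewrite (prE P (measurable_departed _ _)) departed_probability.
rewrite -ge0_sume_distrr; last by move=> i _; exact: integral_ge0.
rewrite -ge0_integral_sum//; last first.
  by move=> i; apply: measurable_funTS; exact: measurable_pr_in_service.
congr (_ * _)%E; apply: eq_integral => u; rewrite inE/= in_itv/= => /andP[u0 _].
rewrite -(prE P (measurable_busy u)) -sum_pr_in_service// -sumEFin.
by apply: eq_bigr => i _; rewrite prE//; exact: measurable_in_service.
Qed.

Lemma departed_le0 t : t <= 0 -> departed t = 0.
Proof.
move=> t0; apply: EFin_inj; rewrite departedE.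
move: t0; rewrite le_eqVlt => /predU1P[->|t0].
  by rewrite set_itv1 integral_set1 mule0.
by rewrite set_itv_ge -?leNgt ?bnd_simp// integral_set0 mule0.
Qed.

Lemma departed_le t : departed t <= N%:R.
Proof.
rewrite /departed -[X in _ <= X%:R]card_ord -sum1_card natr_sum.
by apply: ler_sum => i _; apply: pr_le1; exact: measurable_departed.
Qed.

Lemma departed_bounds u v (m b : R) : 0 <= u -> u <= v -> 0 <= m ->
  (forall x, u <= x <= v -> m <= pr (busy x) <= b) ->
  mu * (m * (v - u)) <= departed v - departed u <= mu * (b * (v - u)).
Proof.
move=> u0 uv m0 mb.
have b0 : 0 <= b.
  have /andP[h1 h2] := mb u (introT andP (conj (lexx u) uv)).
  exact: le_trans m0 (le_trans h1 h2).
have sub : `]u, v]%classic `<=` `[0%R, +oo[%classic.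
  move=> x /=; rewrite !in_itv/= andbT => /andP[ux _].
  exact: le_trans (ltW ux).
have mI : measurable_fun (`]u, v]%classic : set R) (fun x => P (busy x)).
  by apply: measurable_funS sub measurable_pr_busy.
have E : (departed v - departed u)%:E =
    (mu%:E * \int[lebesgue_measure]_(x in `]u, v]) P (busy x))%E.
  rewrite EFinB !departedE (@itv_bndbnd_setU _ _ _ (BRight u)) ?bnd_simp//.
  rewrite ge0_integral_setU//; last 2 first.
  - apply: measurable_funS measurable_pr_busy => // x /= []/=; last exact: sub.
    by rewrite !in_itv/= andbT => /andP[].
  - apply/disj_setPS => x /= [] /=; rewrite !in_itv/= => /andP[_ xu] /andP[].
    by rewrite ltNge xu.
  have fu : (mu%:E * \int[lebesgue_measure]_(x in `[0%R, u]) P (busy x))%E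
      \is a fin_num by rewrite -departedE.
  by rewrite ge0_muleDr ?integral_ge0// addeAC subee ?add0e.
have len : (lebesgue_measure `]u, v] = (v - u)%:E :> \bar R)%E.
  rewrite lebesgue_measure_itv/= lte_fin.
  by move: uv; rewrite le_eqVlt => /predU1P[->|->]//; rewrite ltxx subrr.
rewrite -!lee_fin E !EFinM -len; apply/andP; split.
  rewrite lee_pmul2l// -integral_cst//; apply: ge0_le_integral => //.
  move=> x /=; rewrite in_itv/= => /andP[/ltW ux xv].
  by rewrite -(prE P (measurable_busy x)) lee_fin;
    have /andP[] := mb x (introT andP (conj ux xv)).
rewrite lee_pmul2l// -integral_cst//; apply: ge0_le_integral => //.
move=> x /=; rewrite in_itv/= => /andP[/ltW ux xv].
by rewrite -(prE P (measurable_busy x)) lee_fin;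
    have /andP[] := mb x (introT andP (conj ux xv)).
Qed.

(** The server is busy with probability at most one; as nobody leaves before [0], the bound extends
    to negative times. *)
Lemma departed_incr u v : u <= v -> 0 <= departed v - departed u <= mu * (v - u).
Proof.
move=> uv.
have main x y : 0 <= x -> x <= y -> 0 <= departed y - departed x <= mu * (y - x).
  move=> x0 xy; have := @departed_bounds x y 0 1 x0 xy (lexx 0).
  rewrite mul0r mulr0 mul1r; apply=> z _; rewrite pr_ge0 pr_le1//.
  exact: measurable_busy.
have [v0|v0] := leP v 0.
  rewrite !departed_le0 ?(le_trans uv)// subrr lexx mulr_ge0 ?subr_ge0//.
  exact: ltW.
have [u0|u0] := leP 0 u; first exact: main.
have /andP[h1 h2] := main 0 v (lexx _) (ltW v0).
rewrite (departed_le0 (ltW u0)); rewrite (departed_le0 (lexx 0)) in h1 h2.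
by rewrite h1 (le_trans h2)// ler_pM2l// lerD2l lerN2 ltW.
Qed.

End ModelFacts.

(** * Costs and absence of atoms *)

Section Costs.
Variables (R : realType) (N : nat) (mu : R) (F : cumulativeBounded (0 : R) (1 : R)).
Variables (d : measure_display) (Omega : measurableType d).
Variables (P : probability Omega R) (M : queue_model N mu F P).
Hypothesis mu_gt0 : 0 < mu.

Local Notation T i w := (arrival M i w).
Local Notation S i w := (service M i w).
Local Notation pr := (pr P).
Local Notation dep := (departure_time M).
Local Notation ahead_of := (ahead_of M).

Let mT i : measurable_fun setT (arrival M i). Proof. exact: measurable_funPT. Qed.
Let mG := measurable_positive_service M.
Let prG := pr_positive_service M.

Lemma EA_sum t : EA M t = \sum_(i < N) pr [set w | ahead_of t i w].
Proof.
rewrite /EA -expectation_count; last by move=> i; exact: measurable_ahead_of.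
by congr (fine 'E_P[_]); apply/funext => w; rewrite /arrived num_arrivedE.
Qed.

(** With positive service times, whoever has departed by [t] arrived strictly before [t] and hence
    was ahead; the others ahead are exactly those present. *)
Lemma EQ_sum t : EQ M t = EA M t - departed M t.
Proof.
rewrite EA_sum /departed -sumrB /EQ.
have -> : (fun w => (queue M t w)%:R : R) =
    (fun w => (\sum_(i < N) (ahead_of t i w && (t < dep i w)%R))%N%:R).
  by apply/funext => w; rewrite /queue num_presentE.
rewrite expectation_count; last by move=> i; exact: measurable_present.
apply: eq_bigr => i _.
have mA := measurable_ahead_of M t i; have mD := measurable_departed M t i.
rewrite (pr_split P mA mD) [X in X + _ - _](_ : _ = pr [set w | dep i w <= t]).
  rewrite addrAC subrr add0r; congr (pr _); apply/seteqP; split=> w /=.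
    by move=> /andP[? ?]; split => //; apply/negP; rewrite -ltNge.
  by move=> [-> /negP]; rewrite -ltNge.
apply: (pr_as_eq mG prG) => //; first exact: measurableI.
move=> w Gw; split=> [[]//|/= h]; split=> //.
exact: (departure_ahead (S := fun j => S j w)).
Qed.

Lemma pr_arrival_le i t : pr [set w | T i w <= t] = F t.
Proof.
apply: EFin_inj; rewrite prE; last exact: measurable_set_le.
rewrite -(arrival_cdf M i t) /cdf /distribution /pushforward.
by congr (P _); apply/seteqP; split=> w /=; rewrite in_itv.
Qed.

Let mlt i t : measurable [set w | T i w < t]. Proof. exact: measurable_set_lt. Qed.
Let mle i t : measurable [set w | T i w <= t]. Proof. exact: measurable_set_le. Qed.
Let meq i t : measurable [set w | T i w = t]. Proof. exact: measurable_set_eq. Qed.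
Let mahead := measurable_ahead_of M.

Let mtied i t s : measurable [set w | T i w = t /\ tie M w = s].
Proof. by apply: measurableI; [exact: meq|exact: (measurable_tie M s)]. Qed.

Lemma pr_atom_tie i t s : pr [set w | T i w = t /\ tie M w = s] =
  pr [set w | T i w = t] * (N.+1)`!%:R^-1.
Proof.
pose A j : set R := if j == i then [set t] else setT.
have mA j : measurable (A j) by rewrite /A; case: ifP => _.
have := independent M s mA (fun=> measurableT).
rewrite (_ : mkset _ = [set w | T i w = t /\ tie M w = s]); last first.
  apply/seteqP; split=> w /=.
    by move=> [/(_ i) + _ ->]; rewrite /A eqxx.
  by move=> [h ->]; split=> // j; rewrite /A; case: eqP => // ->.
rewrite tie_uniform [X in (_ * X * _)%E]big1 ?mule1; last first.
  by move=> j _; rewrite preimage_setT probability_setT.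
rewrite (bigD1 i)//= big1 ?mule1; last first.
  by move=> j /negPf ji; rewrite /A ji preimage_setT probability_setT.
rewrite /A eqxx => h; apply: EFin_inj; rewrite EFinM !prE//.
Qed.

Lemma EA_jump i t e : 0 < e ->
  pr [set w | T i w = t] * (N.+1)`!%:R^-1 <= EA M t - EA M (t - e).
Proof.
(* The transposition gives customer [i] the lowest rank, ahead of the tagged customer. *)
move=> e0; pose s0 : {perm 'I_N.+1} := tperm ord0 (lift ord0 i).
rewrite -(pr_atom_tie i t s0) !EA_sum -sumrB (bigD1 i)//=.
set B := [set w | T i w = t /\ tie M w = s0].
have mB : measurable B.
  exact: mtied.
have step j : pr [set w | ahead_of (t - e) j w] <= pr [set w | T j w < t].
  apply: pr_mono => // w /=; rewrite /ahead_of /ahead.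
  have tt : t - e < t by rewrite ltrBlDr ltrDl.
  by move=> /orP[h|/andP[/eqP -> _]]//; exact: lt_trans tt.
have step' j : pr [set w | T j w < t] <= pr [set w | ahead_of t j w].
  by apply: pr_mono => // w /=; rewrite /ahead_of /ahead => ->.
rewrite -[leLHS]addr0; apply: lerD; last first.
  by apply: sumr_ge0 => j _; rewrite subr_ge0 (le_trans (step j)).
rewrite lerBrDl; apply: (@le_trans _ _ (pr [set w | T i w < t] + pr B)).
  by rewrite lerD2r.
rewrite [leRHS](pr_split P (mahead t i) (mlt i t)) lerD//.
  apply: pr_mono => //; first exact: measurableI.
  by move=> w /= h; split=> //; rewrite /ahead_of /ahead h.
apply: pr_mono => //; first exact: measurableD.
move=> w [Tt tieE]; split=> /=; last by rewrite Tt ltxx.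
by rewrite /ahead_of /ahead Tt eqxx tieE ltxx/= tpermL tpermR.
Qed.

(** An atom lies in the support, but arriving [e] earlier avoids a fixed expected number of
    customers, while the departures forgone and the extra delay are of order [e]. *)
Lemma no_atom (alpha beta gamma : R) i t :
  0 < alpha -> 0 <= beta -> 0 <= gamma ->
  symmetric_equilibrium M alpha beta gamma -> pr [set w | T i w = t] = 0.
Proof.
move=> alpha_gt0 beta_ge0 gamma_ge0 equilibrium.
apply/eqP; rewrite eq_le pr_ge0 andbT leNgt; apply/negP => p0.
have supp : arrival_support F t.
  move=> e e0; rewrite -!(pr_arrival_le i).
  rewrite [ltRHS](pr_split P (mle i (t + e)) (meq i t)).
  rewrite -[ltLHS]add0r; apply: ltr_leD.
    apply: lt_le_trans p0 _; apply: pr_mono => //; first exact: measurableI.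
    by move=> w /= ->; split=> //; rewrite lerDl ltW.
  apply: pr_mono => //; first exact: measurableD.
  move=> w /= h; split; first by lra.
  by move=> h'; move: h; rewrite h'; lra.
have [ce [ceE ce_le]] := equilibrium.
set delta := pr [set w | T i w = t] * (N.+1)`!%:R^-1.
have delta0 : 0 < delta by rewrite mulr_gt0// invr_gt0 ltr0n fact_gt0.
(* The saving [(alpha + beta) / mu * delta] is then twice the total loss [(2 * alpha + beta) * e]:
   [(alpha + beta) * e] for the departures forgone and [alpha * e] for the longer delay. *)
pose e := (alpha + beta) / mu * delta / (2 * (2 * alpha + beta)).
have ab0 : 0 < alpha + beta by lra.
have abm0 : 0 < (alpha + beta) / mu by rewrite divr_gt0.
have ab2 : 0 < 2 * (2 * alpha + beta) by lra.
have e0 : 0 < e by rewrite divr_gt0// mulr_gt0.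
have := ce_le (t - e); rewrite -(ceE t supp) /cost !EQ_sum.
have jump := EA_jump i t e0; rewrite -/delta in jump.
have te : t - e <= t by lra.
have /andP[_ dincr] := departed_incr M mu_gt0 te.
have waiting : (alpha + beta) / mu * (delta - mu * e) <=
    (alpha + beta) / mu * ((EA M t - departed M t) - (EA M (t - e) - departed M (t - e))).
  by rewrite ler_pM2l//; lra.
have wE : (alpha + beta) / mu * (delta - mu * e) =
    2 * (2 * alpha + beta) * e - (alpha + beta) * e.
  have <- : (alpha + beta) / mu * delta = 2 * (2 * alpha + beta) * e.
    by rewrite /e [RHS]mulrC divfK ?gt_eqF.
  by rewrite mulrBr [_ * (mu * e)]mulrA divfK ?gt_eqF.
have index : gamma * delta <= gamma * (EA M t - EA M (t - e)) by rewrite ler_wpM2l.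
have gd : 0 <= gamma * delta by rewrite mulr_ge0// ltW.
have ae : 0 < alpha * e by rewrite mulr_gt0.
have be : 0 <= beta * e by rewrite mulr_ge0// ltW.
have ate : alpha * (t - e) = alpha * t - alpha * e by ring.
have bte : beta * (t - e) = beta * t - beta * e by ring.
have [t0|t0] := ltP t 0; have [te0|te0] := ltP (t - e) 0 => /=;
  rewrite ?mulr1 ?mulr0; try lra.
have at0 : 0 <= alpha * t by rewrite pmulr_rge0.
have bt0 : 0 <= beta * t by rewrite mulr_ge0.
lra.
Qed.

End Costs.

(** If nobody else precedes [i], sortedness puts him at the head, and he waits only for the
    server. *)
Lemma service_start_alone (R : realDomainType) (I : eqType) (T S : I -> R)
    (e : rel I) a l i : transitive e -> sorted e l -> i \in l ->
  (forall j, j != i -> ~~ e j i) -> service_start T S a l i = Num.max a (T i).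
Proof.
move=> etr el il ei; have [ij|ij] := eqVneq (index i l) 0%N.
  by rewrite /service_start ij take0.
case: l el il ij => //= j l pathl; rewrite in_cons.
have [->|ji] := eqVneq j i; first by rewrite eqxx.
move=> /= il _.
by have := allP (order_path_min etr pathl) _ il; rewrite (negPf (ei j ji)).
Qed.

(** * The busy probability for an arrival law without atoms *)

Section NoAtoms.
Variables (R : realType) (N : nat) (mu : R) (F : cumulativeBounded (0 : R) (1 : R)).
Variables (d : measure_display) (Omega : measurableType d).
Variables (P : probability Omega R) (M : queue_model N mu F P).
Hypothesis mu_gt0 : 0 < mu.

Local Notation T i w := (arrival M i w).
Local Notation S i w := (service M i w).
Local Notation pr := (pr P).
Local Notation dep := (departure_time M).
Local Notation ahead_of := (ahead_of M).

Hypothesis no_atoms : forall i t, pr [set w | T i w = t] = 0.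

Let mT i : measurable_fun setT (arrival M i). Proof. exact: measurable_funPT. Qed.
Let mG := measurable_positive_service M.
Let prG := pr_positive_service M.
Let mlt i t : measurable [set w | T i w < t]. Proof. exact: measurable_set_lt. Qed.
Let mle i t : measurable [set w | T i w <= t]. Proof. exact: measurable_set_le. Qed.
Let meq i t : measurable [set w | T i w = t]. Proof. exact: measurable_set_eq. Qed.
Let mahead := measurable_ahead_of M.
Let mdep := measurable_departure_time M.

Lemma pr_arrival_lt i t : pr [set w | T i w < t] = F t.
Proof.
rewrite -(pr_arrival_le M i); apply/eqP; rewrite eq_le; apply/andP; split.
  by apply: pr_mono => // w /=; exact: ltW.
rewrite -[leRHS]addr0 -[X in _ + X](no_atoms i t).
by apply: pr_leU => // w /=; rewrite le_eqVlt => /predU1P[]; [right|left].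
Qed.

Lemma pr_ahead t i : pr [set w | ahead_of t i w] = F t.
Proof.
apply/eqP; rewrite eq_le; apply/andP; split.
  rewrite -(pr_arrival_le M i); apply: pr_mono => // w /=.
  by rewrite /ahead_of /ahead => /orP[/ltW|/andP[/eqP ->]].
by rewrite -(pr_arrival_lt i); apply: pr_mono => // w /=; rewrite /ahead_of /ahead => ->.
Qed.

Lemma EA_cdf t : EA M t = N%:R * F t.
Proof.
rewrite EA_sum (eq_bigr (fun=> F t)) => [|i _]; last exact: pr_ahead.
by rewrite sumr_const card_ord mulr_natl.
Qed.

Definition present (t : R) : set Omega :=
  [set w | [exists i, ahead_of t i w && (t < dep i w)]].

Lemma measurable_present_event t : measurable (present t).
Proof. by apply: measurable_exists => i; exact: measurable_present. Qed.
Let mpresent := measurable_present_event.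

Lemma pr_present t : pr (present t) = 1 - PQ0 M t.
Proof.
rewrite -[LHS]opprK -[LHS](subrK 1) addrC; congr (_ + _).
rewrite -[LHS]opprB opprK -prC//; congr (- fine (P _)).
apply/seteqP; split=> w /=; rewrite /queue num_presentE.
  move=> /negP; rewrite negb_exists => /forallP h; rewrite big1// => i _.
  by rewrite (negPf (h i)).
move=> /eqP; rewrite sum_nat_eq0 => /forallP h; apply/negP.
by rewrite negb_exists; apply/forallP => i; have := h i; rewrite eqb0.
Qed.

(** The events differ only if somebody arrives exactly at [t]. *)
Lemma pr_busy t : pr (busy M t) = pr (present t).
Proof.
apply/eqP; rewrite eq_le; apply/andP; split; last first.
  apply: pr_mono => //; first exact: measurable_busy.
  move=> w /existsP[i /andP[ai ti]]; apply/existsP; exists i; rewrite ti andbT.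
  by move: ai; rewrite /ahead_of /ahead => /orP[/ltW|/andP[/eqP ->]].
have meqb i : measurable [set w | T i w == t].
  rewrite (_ : mkset _ = [set w | T i w = t])//.
  by apply/seteqP; split=> w /= /eqP.
apply: (@le_trans _ _ (pr (present t) + pr [set w | [exists i, T i w == t]])).
  apply: pr_leU => //; [exact: measurable_busy|exact: measurable_exists|].
  move=> w /existsP[i /andP[Tt td]].
  move: Tt; rewrite le_eqVlt => /orP[h|h].
    by right; apply/existsP; exists i.
  by left; apply/existsP; exists i; rewrite /ahead_of /ahead h.
rewrite -[leRHS]addr0 lerD2l; apply: le_trans (pr_exists_le P meqb) _.
rewrite big1// => i _; rewrite -(no_atoms i t); congr (pr _).
by apply/seteqP; split=> w /= /eqP.
Qed.

Lemma pr_present_le u : pr (present u) <= N%:R * F u.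
Proof.
apply: le_trans (pr_exists_le P (measurable_present M u)) _.
rewrite -EA_cdf EA_sum; apply: ler_sum => i _; apply: pr_mono => //.
  exact: measurable_present.
by move=> w /= /andP[].
Qed.

Lemma ahead_of_mono u v i w : u <= v -> ahead_of u i w -> ahead_of v i w.
Proof.
move=> uv; rewrite /ahead_of /ahead; move: uv; rewrite le_eqVlt => /predU1P[->//|uv].
by move=> /orP[/lt_trans -> //|/andP[/eqP -> _]]; rewrite uv.
Qed.

Let mnew u v i : measurable [set w | ahead_of v i w && ~~ ahead_of u i w].
Proof.
apply: measurable_andb => //.
rewrite (_ : mkset _ = ~` [set w | ahead_of u i w]); first exact: measurableC.
by apply/seteqP; split=> w /= /negP.
Qed.

Lemma pr_new_arrival u v : u <= v ->
  pr [set w | [exists i, ahead_of v i w && ~~ ahead_of u i w]] <= N%:R * (F v - F u).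
Proof.
move=> uv; apply: le_trans (pr_exists_le P (mnew u v)) _.
rewrite mulrBr -!EA_cdf !EA_sum -sumrB; apply: ler_sum => i _.
rewrite lerBrDr addrC [leRHS](pr_split P (mahead v i) (mahead u i)).
rewrite lerD//.
  apply: pr_mono => //; first exact: measurableI.
  by move=> w /= h; split=> //; exact: ahead_of_mono h.
apply: pr_mono => //; first exact: measurableD.
by move=> w /= /andP[? /negP].
Qed.

(** A system empty at [u] and occupied at [v] has seen an arrival in between; a union bound gives
    the increment of [F]. *)
Lemma pr_present_increase u v : u <= v ->
  pr (present v) <= pr (present u) + N%:R * (F v - F u).
Proof.
move=> uv; apply: le_trans (lerD (lexx _) (pr_new_arrival uv)).
apply: pr_leU => //; first by apply: measurable_exists; exact: mnew.
move=> w /existsP[i /andP[av vd]]; have [au|au] := boolP (ahead_of u i w).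
  by left; apply/existsP; exists i; rewrite au (le_lt_trans uv).
by right; apply/existsP; exists i; rewrite av.
Qed.

(** Emptying the system takes a departure in []u, v]], and the expected number of these is at most
    [mu * (v - u)]. With the bound on the increase this makes the probability continuous. *)
Lemma pr_present_decrease u v : u <= v ->
  pr (present u) <= pr (present v) + mu * (v - u).
Proof.
move=> uv.
have mleft i : measurable [set w | u < dep i w <= v].
  apply: measurable_andb; last exact: measurable_departed.
  exact: measurable_set_lt.
apply: (@le_trans _ _ (pr (present v) + pr [set w | [exists i, u < dep i w <= v]])).
  apply: pr_leU => //; first exact: measurable_exists.
  move=> w /existsP[i /andP[au ud]]; have [dv|vd] := leP (dep i w) v.
    by right; apply/existsP; exists i; rewrite ud.
  by left; apply/existsP; exists i; rewrite vd (ahead_of_mono uv).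
rewrite lerD2l; apply: le_trans (pr_exists_le P mleft) _.
have /andP[_] := departed_incr M mu_gt0 uv; apply: le_trans.
rewrite /departed -sumrB; apply: ler_sum => i _.
rewrite lerBrDr addrC.
rewrite [leRHS](pr_split P (measurable_departed M v i) (measurable_departed M u i)).
have mD := measurable_departed M.
rewrite lerD//.
  apply: pr_mono => //; first exact: measurableI.
  by move=> w /= h; split=> //; exact: le_trans uv.
apply: pr_mono => //; first exact: measurableD.
by move=> w /= /andP[ud dv]; split=> //; apply/negP; rewrite -ltNge.
Qed.

Lemma pr_present0 : (0 < N)%N -> F 0 = 1 -> pr (present 0) = 1.
Proof.
move=> N0 F0; apply/eqP; rewrite eq_le pr_le1//=.
rewrite -F0 -(pr_ahead 0 (Ordinal N0)); apply: (pr_as_le mG prG) => // w Gw ai.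
apply/existsP; exists (Ordinal N0); rewrite ai /departure_time.
by rewrite ltr_wpDl//; exact: (start_ge0 _ _ Gw).
Qed.

Lemma pr_service_le i a : 0 <= a -> pr [set w | S i w <= a] = 1 - expR (- mu * a).
Proof.
move=> a0; apply: EFin_inj; rewrite prE; last exact: measurable_set_le.
have := service_exponential M i (measurable_itv `]-oo, a]).
rewrite exponential_prob_le a0 mulr1n => <-.
by congr (P _); apply/seteqP; split=> w /=; rewrite in_itv.
Qed.

Lemma pr_service_itv i u v : 0 <= u -> u < v ->
  0 < pr [set w | u < S i w <= v].
Proof.
move=> u0 uv; have v0 := le_trans u0 (ltW uv).
have mSle a : measurable [set w | S i w <= a] by exact: measurable_set_le.
have : expR (- mu * v) < expR (- mu * u).
  by rewrite ltr_expR !mulNr ltrN2 ltr_pM2l.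
have := pr_split P (mSle v) (mSle u); rewrite !pr_service_le//.
have : pr ([set w | S i w <= v] `&` [set w | S i w <= u]) <= 1 - expR (- mu * u).
  by rewrite -(pr_service_le i)//; apply: pr_mono => //; exact: measurableI.
rewrite [_ `\` _](_ : _ = [set w | u < S i w <= v]); first by lra.
apply/seteqP; split=> w /=.
  by move=> [-> /negP]; rewrite -ltNge => ->.
by move=> /andP[uS ->]; split=> //; apply/negP; rewrite -ltNge.
Qed.

(* With positive probability one customer arrives before [0], his service takes
   between [u] and [v], and all the others arrive after [v]. *)
Lemma pr_present_gap u v : (0 < N)%N -> 0 <= u -> u < v -> F u = F v ->
  0 < F 0 -> F v < 1 -> pr (present v) < pr (present u).
Proof.
move=> N0 u0 uv Fuv F0 Fv1; pose i := Ordinal N0.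
pose A j : set R := if j == i then [set` `]-oo, 0[] else [set` `]v, +oo[].
pose B j : set R := if j == i then [set` `]u, v]] else setT.
have mA j : measurable (A j) by rewrite /A; case: ifP.
have mB j : measurable (B j) by rewrite /B; case: ifP.
(* The tie-breaking order is fixed because [independent] concerns one order at a time; each has
   positive probability. *)
pose E := [set w | [/\ forall j, A j (T j w), forall j, B j (S j w) & tie M w = 1%g]].
have PE : P E = _ := independent M 1%g mA mB.
have mE : measurable E.
  rewrite (_ : E = (\bigcap_(j in [set: 'I_N]) (arrival M j @^-1` A j)) `&`
    (\bigcap_(j in [set: 'I_N]) (service M j @^-1` B j)) `&` [set w | tie M w = 1%g]).
    apply: measurableI; last exact: (measurable_tie M 1%g).
    apply: measurableI; apply: fin_bigcap_measurable => // j _.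
      by rewrite -[X in measurable X]setTI; exact: mT.
    by rewrite -[X in measurable X]setTI; apply: (measurable_funPT (service M j)).
  apply/seteqP; split=> w /=.
    by move=> [hA hB hs]; split => //; split=> j _; [exact: hA|exact: hB].
  by move=> [[hA hB] hs]; split => // j; [exact: hA|exact: hB].
have prE0 : 0 < pr E.
  rewrite -lte_fin prE// PE tie_uniform !mule_gt0//.
  - apply: (big_ind (fun x : \bar R => (0 < x)%E)) => [|x y|j _]; [exact: lte01|exact: mule_gt0|].
    rewrite /A; case: eqP => _.
      rewrite (_ : _ @^-1` _ = [set w | T j w < 0]); last first.
        by apply/seteqP; split=> w /=; rewrite in_itv.
      by rewrite -prE// pr_arrival_lt lte_fin.
    rewrite (_ : _ @^-1` _ = ~` [set w | T j w <= v]); last first.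
      apply/seteqP; split=> w /=; rewrite in_itv/= andbT ltNge; first by move/negP.
      by move/negP.
    by rewrite -prE; [rewrite prC// pr_arrival_le lte_fin subr_gt0|exact: measurableC].
  - apply: (big_ind (fun x : \bar R => (0 < x)%E)) => [|x y|j _]; [exact: lte01|exact: mule_gt0|].
    rewrite /B; case: eqP => _; last by rewrite preimage_setT probability_setT.
    rewrite (_ : _ @^-1` _ = [set w | u < S j w <= v]); last first.
      by apply/seteqP; split=> w /=; rewrite in_itv.
    rewrite -prE ?lte_fin ?pr_service_itv//.
    by apply: measurable_andb; [exact: measurable_set_lt|exact: measurable_set_le].
have v0 := le_trans u0 (ltW uv).
have EiT w : E w -> T i w < 0 by move=> [/(_ i) + _ _]; rewrite /A eqxx/= in_itv.
have EjT w j : E w -> j != i -> v < T j w.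
  by move=> [/(_ j) + _ _] /negPf ji; rewrite /A ji/= in_itv/= andbT.
have EiS w : E w -> u < S i w <= v by move=> [_ /(_ i) + _]; rewrite /B eqxx/= in_itv.
have startE w : E w -> start_time M i w = 0.
  move=> Ew; rewrite /start_time /start.
  rewrite (@service_start_alone _ _ _ _ (arrival_order (fun j => T j w) (tie M w))).
  - by apply/max_idPl/ltW/EiT.
  - exact: arrival_order_trans.
  - exact: sorted_order_list.
  - exact: mem_order_list.
  move=> j ji; rewrite /arrival_order.
  have Tij : T i w < T j w.
    exact: lt_trans (EiT _ Ew) (le_lt_trans v0 (EjT _ _ Ew ji)).
  by rewrite ltNge (ltW Tij) gt_eqF.
(* On [E] the system is occupied at [u] and empty at [v]. Outside [E], being occupied at [v] almost
   surely implies being occupied at [u], since nobody arrives in between. *)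
apply: (@lt_le_trans _ _ (pr (present v) + pr E)); first by rewrite ltrDl.
rewrite [leRHS](pr_split P (mpresent u) mE) addrC lerD//.
  apply: (pr_as_le mG prG) => //; first exact: measurableI.
  move=> w Gw Ew; split=> //; apply/existsP; exists i.
  have /andP[uS _] := EiS _ Ew.
  rewrite /departure_time startE// add0r uS andbT /ahead_of /ahead.
  by rewrite (lt_le_trans (EiT _ Ew)).
have := pr_new_arrival (ltW uv); rewrite Fuv subrr mulr0.
rewrite -(lerD2l (pr (present u `\` E))) addr0; apply: le_trans.
apply: (pr_as_leU mG prG) => //; [exact: measurableD|by apply: measurable_exists; exact: mnew|].
move=> w Gw /existsP[j /andP[av vd]].
have [au|au] := boolP (ahead_of u j w); last by right; apply/existsP; exists j; rewrite av.
left; split; first by apply/existsP; exists j; rewrite au (le_lt_trans (ltW uv)).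
move=> Ew; have [ji|ji] := eqVneq j i.
  move: vd; rewrite ji /departure_time startE// add0r ltNge.
  by have /andP[_ ->] := EiS _ Ew.
have := EjT _ _ Ew ji; move: av; rewrite /ahead_of /ahead.
by case: ltgtP.
Qed.

End NoAtoms.

(** * Equilibria of the deterministic cost *)

(** [s] is the infimum of the points where [F] is at least [F x]; [x0] bounds it below and right
    continuity makes it attained. *)
Lemma level_left_end (R : realType) (F : R -> R) x0 x :
  {homo F : u v / u <= v} ->
  (forall u y, F u < y -> exists2 v, u < v & F v < y) -> F x0 < F x ->
  exists s, [/\ s <= x, F s = F x & forall z, z < s -> F z < F x].
Proof.
move=> Fnd Frc Fx0; pose A := [set z | F x <= F z].
have Ax : A x by rewrite /A/=.
have lbA : lbound A x0.
  by move=> z Az; rewrite leNgt; apply/negP => /ltW/Fnd; rewrite leNgt (lt_le_trans Fx0).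
have hA : has_lbound A by exists x0.
have sx : inf A <= x by exact: ge_inf.
exists (inf A); split=> //; last first.
  by move=> z zs; rewrite ltNge; apply/negP => /(ge_inf hA); rewrite leNgt zs.
apply/eqP; rewrite eq_le Fnd//= leNgt; apply/negP => /Frc[v sv Fv].
have [z Az zv] := inf_lt (ex_intro _ x Ax) sv.
by move: Fv; rewrite ltNge (le_trans Az)// Fnd// ltW.
Qed.

Lemma level_right_end (R : realType) (F : R -> R) x x1 :
  {homo F : u v / u <= v} ->
  (forall u y, y < F u -> exists2 v, v < u & y < F v) -> F x < F x1 ->
  exists s, [/\ x <= s, F s = F x & forall z, s < z -> F x < F z].
Proof.
move=> Fnd Flc Fx1.
(* Reflecting the graph through the origin exchanges left and right continuity. *)
have [||/=|s [sx Fs sz]] := @level_left_end R (fun z => - F (- z)) (- x1) (- x).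
- by move=> u v uv; rewrite lerN2; apply: Fnd; rewrite lerN2.
- move=> u y; rewrite ltrNl => /Flc[v vu Fv]; exists (- v); first by rewrite ltrNr.
  by rewrite opprK ltrNl.
- by rewrite !opprK ltrN2.
exists (- s); split.
- by rewrite lerNr.
- by move: Fs => /oppr_inj; rewrite opprK.
- by move=> z zs; have := sz (- z); rewrite !opprK ltrN2; apply; rewrite ltrNl.
Qed.

(** Constant cost yields bounds on the slope over all short intervals near [t]; those with one end
    at [t] control the difference quotient. *)
Lemma is_derive_slope (R : realType) (f : R -> R) (t l : R) :
  (forall e, 0 < e -> exists2 r, 0 < r & forall u v,
     `|u - t| < r -> `|v - t| < r -> u <= v ->
     (l - e) * (v - u) <= f v - f u <= (l + e) * (v - u)) ->
  is_derive t 1 f l.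
Proof.
move=> slope.
have cvgf : h^-1 *: (f (h *: 1 + t) - f t) @[h --> 0^'] --> l.
  apply/cvgrPdist_le => e e0; have [r r0 hr] := slope e e0.
  near=> h; have h0 : h != 0 by near: h; exact: nbhs_dnbhs_neq.
  have hlt : `|h| < r.
    near: h; apply: dnbhs0_lt => //.
  rewrite /GRing.scale/= mulr1; have tt : `|t - t| < r by rewrite subrr normr0.
  have ht : `|h + t - t| < r by rewrite addrK.
  rewrite ler_norml; have [hpos|hneg] := ltP 0 h.
    have tht : t <= h + t by rewrite lerDr ltW.
    have := hr _ _ tt ht tht; rewrite addrK => /andP[h1 h2].
    rewrite mulrC; apply/andP; split.
      by rewrite lerBrDl -lerBrDr ler_pdivrMr//; lra.
    by rewrite lerBlDl -lerBlDr ler_pdivlMr//; lra.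
  have {hneg}hneg : h < 0 by rewrite lt_neqAle h0.
  have tht : h + t <= t by rewrite gerDr ltW.
  have := hr _ _ ht tt tht; rewrite (_ : t - (h + t) = - h); last by ring.
  move=> /andP[h1 h2]; rewrite mulrC; apply/andP; split.
    by rewrite lerBrDl -lerBrDr ler_ndivrMr//; lra.
  by rewrite lerBlDl -lerBlDr ler_ndivlMr//; lra.
apply: DeriveDef; first by apply/cvg_ex; exists l.
exact: cvg_lim cvgf.
Unshelve. all: by end_near.
Qed.

(** Membership in [arrival_support], restated for a bare function so that the analytic part is free
    of probability. *)
Definition increase_point (R : realType) (F : R -> R) t :=
  forall e, 0 < e -> F (t - e) < F (t + e).

(* [F] is the arrival distribution, [g t] the probability that the server is
   busy at time [t], [mu * J t] the expected number of departures up to [t], and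
   [c] the cost, constant on the support of [F]. *)
Record equilibrium_profile (R : realType) (F g J c : R -> R)
    (alpha beta mu n K ce : R) : Prop := EquilibriumProfile {
  profile_alpha_gt0 : 0 < alpha;
  profile_beta_ge0 : 0 <= beta;
  profile_mu_gt0 : 0 < mu;
  profile_n_gt0 : 0 < n;
  profile_K_gt0 : 0 < K;
  profile_F_nd : {homo F : x y / x <= y};
  profile_F_rc : forall x y, F x < y -> exists2 z, x < z & F z < y;
  profile_F_lc : forall x y, y < F x -> exists2 z, z < x & y < F z;
  profile_F_ge0 : forall x, 0 <= F x;
  profile_F_le1 : forall x, F x <= 1;
  profile_F_lim0 : forall e, 0 < e -> exists x, F x < e;
  profile_F_lim1 : forall e, 0 < e -> exists x, 1 - e < F x;
  profile_g_le : forall u, g u <= n * F u;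
  profile_g_ge0 : forall u, 0 <= g u;
  profile_g_increase : forall u v, u <= v -> g v <= g u + n * (F v - F u);
  profile_g_decrease : forall u v, u <= v -> g u <= g v + mu * (v - u);
  profile_g_start : F 0 = 1 -> g 0 = 1;
  profile_g_gap : forall u v, 0 <= u -> u < v -> F u = F v ->
  0 < F 0 -> F v < 1 -> g v < g u;
  profile_J0 : J 0 = 0;
  profile_J_lower : forall u v m, 0 <= u -> u <= v ->
  (forall x, u <= x <= v -> m <= g x) -> m * (v - u) <= J v - J u;
  profile_J_upper : forall u v b, 0 <= u -> u <= v ->
  (forall x, u <= x <= v -> g x <= b) -> J v - J u <= b * (v - u);
  profile_J_le : forall u, J u <= n / mu;
  profile_c_neg : forall t, t <= 0 -> c t = - alpha * t + K * F t;
  profile_c_pos : forall t, 0 <= t -> c t = beta * t + K * F t - (alpha + beta) * J t;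
  profile_c_eq : forall t, increase_point F t -> c t = ce;
  profile_c_ge : forall t, ce <= c t
}.

(** * Support and slope of an equilibrium profile *)

Section Equilibrium.
Variables (R : realType) (F g J c : R -> R) (alpha beta mu n K ce : R).
Hypothesis profile : equilibrium_profile F g J c alpha beta mu n K ce.

Let alpha_gt0 := profile_alpha_gt0 profile.
Let beta_ge0 := profile_beta_ge0 profile.
Let mu_gt0 := profile_mu_gt0 profile.
Let n_gt0 := profile_n_gt0 profile.
Let K_gt0 := profile_K_gt0 profile.
Let F_nd := profile_F_nd profile.
Let F_rc := profile_F_rc profile.
Let F_lc := profile_F_lc profile.
Let F_ge0 := profile_F_ge0 profile.
Let F_le1 := profile_F_le1 profile.
Let F_lim0 := profile_F_lim0 profile.
Let F_lim1 := profile_F_lim1 profile.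
Let g_le := profile_g_le profile.
Let g_ge0 := profile_g_ge0 profile.
Let g_increase := profile_g_increase profile.
Let g_decrease := profile_g_decrease profile.
Let g_start := profile_g_start profile.
Let g_gap := profile_g_gap profile.
Let J0 := profile_J0 profile.
Let J_lower := profile_J_lower profile.
Let J_upper := profile_J_upper profile.
Let J_le := profile_J_le profile.
Let c_neg := profile_c_neg profile.
Let c_pos := profile_c_pos profile.
Let c_eq := profile_c_eq profile.
Let c_ge := profile_c_ge profile.

Local Notation increase_point := (increase_point F).

Let ab_gt0 : 0 < alpha + beta.
Proof. by rewrite ltr_wpDr. Qed.

Lemma left_increase_point x : 0 < F x ->
  exists s, [/\ s <= x, F s = F x, increase_point s & forall z, z < s -> F z < F x].
Proof.
move=> /F_lim0[x0 Fx0]; have [s [sx Fs sz]] := level_left_end F_nd F_rc Fx0.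
exists s; split=> // e e0; apply: (@lt_le_trans _ _ (F s)).
  by rewrite Fs; apply: sz; rewrite ltrBlDr ltrDl.
by apply: F_nd; rewrite lerDl ltW.
Qed.

Lemma right_increase_point x : F x < 1 ->
  exists s, [/\ x <= s, F s = F x, increase_point s & forall z, s < z -> F x < F z].
Proof.
move=> Fx1; have [|x1] := F_lim1 (e := 1 - F x); first by rewrite subr_gt0.
rewrite opprB addrC subrK => Fx1'.
have [s [sx Fs sz]] := level_right_end F_nd F_lc Fx1'.
exists s; split=> // e e0; apply: (@le_lt_trans _ _ (F s)).
  by apply: F_nd; rewrite lerBlDr lerDl ltW.
by rewrite Fs; apply: sz; rewrite ltrDl.
Qed.

Lemma increase_point_between s x y :
  increase_point s -> x < s -> s < y -> F x < F y.
Proof.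
move=> si xs sy; pose e := Num.min (s - x) (y - s).
have e0 : 0 < e by rewrite /e lt_min !subr_gt0 xs.
apply: le_lt_trans (lt_le_trans (si e e0) _); apply: F_nd.
  by rewrite lerBrDr -lerBrDl ge_min lexx.
by rewrite -lerBrDl ge_min lexx orbT.
Qed.

Lemma increase_point_ge x s : increase_point s -> s < x -> 0 < F x.
Proof.
move=> si sx; apply: le_lt_trans (F_ge0 (s - 1)) _.
by apply: increase_point_between si _ sx; rewrite ltrBlDr ltrDl.
Qed.

Lemma increase_point_le x s : increase_point s -> x < s -> F x < 1.
Proof.
move=> si xs; apply: lt_le_trans (F_le1 (s + 1)).
by apply: increase_point_between si xs _; rewrite ltrDl.
Qed.

(* If nobody arrived before time [0], arrivals just after the first one would
   cost more than arriving at [0]: the queue, at most [n F], is negligible. *)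
Lemma F0_gt0 : 0 < F 0.
Proof.
rewrite lt_neqAle F_ge0 andbT; apply/eqP => F0.
have [|s0 [s00 Fs0 _ s0z]] := right_increase_point (x := 0); first by rewrite -F0 ltr01.
have ce0 : ce <= 0 by have := c_ge 0; rewrite c_neg// mulr0 -F0 mulr0 addr0.
have abn : 0 < 2 * ((alpha + beta) * n) by rewrite mulr_gt0// mulr_gt0.
(* With this [h], [(alpha + beta) * (n * F t * h)] is half of [K * F t], so the cost at [t] stays
   positive although [ce <= 0]. *)
pose h := K / (2 * ((alpha + beta) * n)).
have h0 : 0 < h by rewrite divr_gt0.
(* [s0] is the last zero of [F]; the left end of the level of [F (s0 + h)] is a point of increase in
   []s0, s0 + h]]. *)
have [|t [tz Ft ti tlt]] := left_increase_point (x := s0 + h).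
  by rewrite F0 s0z// ltrDl.
have Fsh : F 0 < F (s0 + h) by rewrite s0z// ltrDl.
have st : s0 < t.
  by rewrite ltNge; apply/negP => /F_nd; rewrite Fs0 Ft leNgt Fsh.
have t0 : 0 <= t by rewrite (le_trans s00)// ltW.
have Js0 : J s0 - J 0 <= 0 * (s0 - 0).
  apply: J_upper => // x /andP[x0 xs]; apply: le_trans (g_le x) _.
  have Fx : F x <= 0 by rewrite [leRHS]F0 -Fs0; exact: F_nd.
  by rewrite pmulr_rle0.
have Jt : J t - J s0 <= n * F t * (t - s0).
  apply: J_upper => //; first exact: ltW.
  move=> x /andP[sx xt]; apply: le_trans (g_le x) _.
  by rewrite ler_pM2l// F_nd.
have := c_eq ti; rewrite c_pos// => ceE.
have bt : 0 <= beta * t by rewrite mulr_ge0.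
have Ft0 : 0 < F t by rewrite Ft F0.
have Jt' : J t <= n * F t * h.
  have : n * F t * (t - s0) <= n * F t * h.
    by rewrite ler_pM2l ?mulr_gt0//; lra.
  by rewrite mul0r J0 in Js0; lra.
have : (alpha + beta) * J t <= (alpha + beta) * (n * F t * h).
  by rewrite ler_pM2l.
have -> : (alpha + beta) * (n * F t * h) = K * F t / 2.
  by rewrite /h; field; rewrite !gt_eqF.
have : 0 < K * F t by rewrite mulr_gt0.
lra.
Qed.

(* On a gap of the support the cost would be convex with equal end values and
   never below them, hence constant, although [g] decreases strictly. *)
Lemma increase_point_inner t : 0 < F t -> F t < 1 -> increase_point t.
Proof.
move=> Ft0 Ft1.
have [x [xt Fx xi _]] := left_increase_point Ft0.
have [y [ty Fy yi _]] := right_increase_point Ft1.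
have [xy|xy] := eqVneq x y; first by have -> : t = x by apply/eqP; rewrite eq_le xt {1}xy ty.
have {xy}xy : x < y by rewrite lt_neqAle xy (le_trans xt).
have Fxy z : x <= z -> z <= y -> F z = F t.
  by move=> xz zy; apply/eqP; rewrite eq_le -{1}Fy -Fx !F_nd.
exfalso; have cx := c_eq xi; have cy := c_eq yi.
have axy : 0 < alpha * (y - x) by rewrite mulr_gt0// subr_gt0.
(* Below [0] the cost falls at rate [alpha] on the gap, so its ends cannot cost the same; on a gap
   that straddles [0], arriving at [0] beats the left end. *)
have [y0|y0] := leP y 0.
  by move: cx cy; rewrite !c_neg// ?(le_trans (ltW xy))// Fx Fy; lra.
have [x0|x0] := ltP x 0.
  have := c_ge 0; rewrite c_neg// mulr0 add0r (Fxy 0 (ltW x0) (ltW y0)).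
  move: cx; rewrite (c_neg (ltW x0)) Fx.
  have : alpha * x < 0 by rewrite pmulr_rlt0.
  lra.
have F0 := F0_gt0.
(* Comparing [c m] with [c x] bounds [(alpha + beta) * g m] above by [beta], comparing it with [c y]
   bounds it below, because [g] is nonincreasing on the gap. *)
have g_const m : x < m -> m < y -> (alpha + beta) * g m = beta.
  move=> xm my; have m0 : 0 <= m by rewrite (le_trans x0)// ltW.
  have gmono u v : x <= u -> u <= v -> v <= y -> g v <= g u.
    move=> xu; rewrite le_eqVlt => /predU1P[->//|uv] vy.
    have vF := Fxy v (le_trans xu (ltW uv)) vy.
    apply/ltW/g_gap => //; first exact: le_trans xu.
      by rewrite vF Fxy// (le_trans (ltW uv)).
    by rewrite vF.
  have J1 : g m * (m - x) <= J m - J x.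
    apply: J_lower => //; first exact: ltW.
    by move=> z /andP[xz zm]; apply: gmono => //; exact: ltW.
  have J2 : J y - J m <= g m * (y - m).
    apply: J_upper => //; first exact: ltW.
    by move=> z /andP[mz zy]; apply: gmono => //; exact: ltW.
  have cm := c_ge m; move: cx cy cm; rewrite !c_pos// ?(le_trans x0 (ltW xy))//.
  rewrite Fx Fy (Fxy m (ltW xm) (ltW my)) => cx cy cm.
  apply/eqP; rewrite eq_le; apply/andP; split.
    have mx : 0 < m - x by rewrite subr_gt0.
    rewrite -(ler_pM2r mx).
    have : (alpha + beta) * (g m * (m - x)) <= (alpha + beta) * (J m - J x).
      by rewrite ler_pM2l.
    lra.
  have ym : 0 < y - m by rewrite subr_gt0.
  rewrite -(ler_pM2r ym).
  have : (alpha + beta) * (J y - J m) <= (alpha + beta) * (g m * (y - m)).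
    by rewrite ler_pM2l.
  lra.
pose m1 := x + (y - x) / 3; pose m2 := x + 2 * (y - x) / 3.
have xm1 : x < m1 by rewrite /m1; lra.
have m12 : m1 < m2 by rewrite /m1 /m2; lra.
have m2y : m2 < y by rewrite /m2; lra.
have F1 : F m1 = F t by rewrite Fxy// ltW// (lt_trans m12).
have F2 : F m2 = F t by rewrite Fxy// ltW// (lt_trans xm1).
have : g m2 < g m1.
  by apply: g_gap; rewrite ?F1 ?F2//; exact: le_trans (ltW xm1).
have gE : (alpha + beta) * g m1 = (alpha + beta) * g m2.
  by rewrite !g_const// (lt_trans xm1, lt_trans m12).
by rewrite (mulfI (lt0r_neq0 ab_gt0) gE) ltxx.
Qed.

(* Otherwise everybody has arrived by time [0], and a customer arriving just
   after [0] would gain [alpha] per unit of time. *)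
Lemma increase_point_gt0 : exists2 s, 0 < s & increase_point s.
Proof.
apply: contrapT => noS.
have Fpos z : 0 < z -> F z = 1.
  move=> z0; apply/eqP; rewrite eq_le F_le1 leNgt; apply/negP.
  move=> /right_increase_point[s [zs _ si _]].
  by apply: noS; exists s => //; exact: lt_le_trans zs.
have F0 : F 0 = 1.
  apply/eqP; rewrite eq_le F_le1 leNgt; apply/negP => /F_rc[z z0].
  by rewrite Fpos// ltxx.
have F0_0 : 0 < F 0 by rewrite F0.
have [s [s0 Fs si _]] := left_increase_point F0_0.
have cs := c_eq si; rewrite c_neg// Fs F0 in cs.
have [s0'|s0'] := ltP s 0.
  have := c_ge 0; rewrite c_neg// F0.
  have : alpha * s < 0 by rewrite pmulr_rlt0.
  lra.
have {s0'}s0 : s = 0 by apply/eqP; rewrite eq_le s0.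
rewrite {}s0 in cs.
(* On [[0, e]] the server is busy with probability at least [1 - mu * e]; for this [e] the
   second-order loss [(alpha + beta) * mu * e * e] is half of the gain [alpha * e]. *)
pose e := alpha / (2 * (alpha + beta) * mu).
have e0 : 0 < e by rewrite divr_gt0 ?mulr_gt0.
have Je : (1 - mu * e) * (e - 0) <= J e - J 0.
  apply: J_lower => //; first exact: ltW.
  move=> x /andP[x0 xe]; have := g_decrease x0; rewrite g_start// subr0.
  have : mu * x <= mu * e by rewrite ler_pM2l.
  lra.
have := c_ge e; rewrite c_pos ?(ltW e0)// (Fpos _ e0).
have : (alpha + beta) * ((1 - mu * e) * e) <= (alpha + beta) * J e.
  by rewrite ler_pM2l//; rewrite J0 !subr0 in Je.
have -> : (alpha + beta) * ((1 - mu * e) * e) = (alpha + beta) * e - alpha * e / 2.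
  by rewrite /e; field; rewrite !gt_eqF.
have : 0 < alpha * e by rewrite mulr_gt0.
lra.
Qed.

Lemma increase_point_lower s : increase_point s -> - ce / alpha <= s.
Proof.
move=> si; have := c_eq si; have [s0|s0] := leP s 0.
  rewrite c_neg// => <-; rewrite ler_pdivrMr//.
  have : 0 <= K * F s by rewrite mulr_ge0// ltW.
  lra.
(* For positive [s] the claim reduces to [0 <= ce], read off at a support point at or below [0],
   which exists because [0 < F 0]. *)
move=> _; apply: le_trans (ltW s0); rewrite pmulr_lle0 ?invr_gt0// oppr_le0.
have [x [xs Fx xi _]] := left_increase_point F0_gt0.
rewrite -(c_eq xi) c_neg// Fx.
have : alpha * x <= 0 by rewrite pmulr_rle0.
have : 0 <= K * F 0 by rewrite mulr_ge0// ltW.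
lra.
Qed.

(** Tardiness grows linearly, while the relief through departures is bounded, as at most [n]
    customers ever leave. *)
Lemma increase_point_upper s : 0 < beta -> increase_point s ->
  s <= Num.max 0 ((ce + (alpha + beta) * (n / mu)) / beta).
Proof.
move=> b0 si; rewrite le_max; have [//|s0] := leP s 0.
rewrite /= ler_pdivlMr// -(c_eq si) (c_pos (ltW s0)).
have : (alpha + beta) * J s <= (alpha + beta) * (n / mu) by rewrite ler_pM2l.
have : 0 <= K * F s by rewrite mulr_ge0// ltW.
lra.
Qed.

Lemma F_modulus t e : 0 < e ->
  exists2 r, 0 < r & forall s, `|s - t| < r -> `|F s - F t| < e.
Proof.
move=> e0; have [v tv Fv] : exists2 v, t < v & F v < F t + e by apply: F_rc; rewrite ltrDl.
have [u ut Fu] : exists2 u, u < t & F t - e < F u by apply: F_lc; rewrite ltrBlDr ltrDl.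
exists (Num.min (v - t) (t - u)); first by rewrite lt_min !subr_gt0 tv.
move=> s; rewrite lt_min !ltr_norml => /andP[/andP[_ sv] /andP[us _]].
rewrite ltrBlDl; apply/andP; split.
  by rewrite ltrBrDl (lt_le_trans Fu)// F_nd//; lra.
by apply: le_lt_trans Fv; apply: F_nd; lra.
Qed.

Lemma g_modulus t e : 0 < e ->
  exists2 r, 0 < r & forall s, `|s - t| < r -> `|g s - g t| < e.
Proof.
move=> e0; have [|r r0 Fr] := @F_modulus t (e / n); first by rewrite divr_gt0.
have em0 : 0 < e / mu by rewrite divr_gt0.
exists (Num.min r (e / mu)); first by rewrite lt_min r0.
move=> s; rewrite lt_min => /andP[/Fr].
rewrite ltr_pdivlMr// ltr_pdivlMr//.
have nn : `|F s - F t| * n = `|n * (F s - F t)|.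
  by rewrite normrM mulrC [in RHS](gtr0_norm n_gt0).
rewrite nn ltr_norml => /andP[F1 F2] smu.
have ss : `|mu * (s - t)| < e by rewrite normrM mulrC (gtr0_norm mu_gt0).
move: ss; rewrite !ltr_norml => /andP[s1 s2].
have [st|ts] := leP s t.
  have := g_increase st; have := g_decrease st.
  have -> : mu * (t - s) = - (mu * (s - t)) by ring.
  have -> : n * (F t - F s) = - (n * (F s - F t)) by ring.
  by move=> *; apply/andP; split; lra.
have := g_increase (ltW ts); have := g_decrease (ltW ts).
by move=> *; apply/andP; split; lra.
Qed.

(** Equal costs at [u] and [v] turn the increment of [K * F] into that of [(alpha + beta) * J] minus
    [beta * (v - u)]. *)
Lemma F_slope u v m b : 0 <= u -> u <= v -> c u = ce -> c v = ce ->
  (forall x, u <= x <= v -> m <= g x <= b) ->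
  ((alpha + beta) * m - beta) / K * (v - u) <= F v - F u
    <= ((alpha + beta) * b - beta) / K * (v - u).
Proof.
move=> u0 uv cu cv mb; have v0 := le_trans u0 uv.
have J1 : m * (v - u) <= J v - J u by apply: J_lower => // x /mb/andP[].
have J2 : J v - J u <= b * (v - u) by apply: J_upper => // x /mb/andP[].
have J1' : (alpha + beta) * (m * (v - u)) <= (alpha + beta) * (J v - J u).
  by rewrite ler_pM2l.
have J2' : (alpha + beta) * (J v - J u) <= (alpha + beta) * (b * (v - u)).
  by rewrite ler_pM2l.
move: cu cv; rewrite !c_pos// => cu cv.
rewrite ![_ / K * _]mulrAC ler_pdivrMr// ler_pdivlMr//.
by apply/andP; split; lra.
Qed.

Lemma inner_pos s t : 0 <= t -> t < s -> increase_point s -> c t = ce.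
Proof.
move=> t0 ts si; apply/c_eq/increase_point_inner.
  exact: lt_le_trans F0_gt0 (F_nd t0).
exact: increase_point_le si ts.
Qed.

(** A negative value at [t] would persist nearby by continuity of [g], and [F_slope] would make [F]
    decrease. The second hypothesis lets [t] be the upper end of the support. *)
Lemma inflow_ge0 t : 0 <= t -> (forall x, x < t -> exists2 s, x < s & increase_point s) ->
  0 <= ((alpha + beta) * g t - beta) / K.
Proof.
move=> t0 below; rewrite leNgt; apply/negP.
rewrite pmulr_llt0 ?invr_gt0// subr_lt0 => ht.
pose b := beta / (alpha + beta).
have bE : (alpha + beta) * b = beta by rewrite /b mulrC divfK ?gt_eqF.
have gb : g t < b by rewrite -(ltr_pM2l ab_gt0) bE.
pose e := (b - g t) / 2; have e0 : 0 < e by rewrite divr_gt0// subr_gt0.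
have [r r0 gr] := g_modulus t e0.
suff [u [v [u0 uv cu cv uvt]]] : exists u v, [/\ 0 <= u, u < v, c u = ce, c v = ce &
    forall x, u <= x <= v -> `|x - t| < r].
  have gx x : u <= x <= v -> 0 <= g x <= b - e.
    move=> /uvt/gr; rewrite ltr_norml g_ge0 /= => /andP[_].
    by rewrite /e; lra.
  have /andP[_] := F_slope u0 (ltW uv) cu cv gx.
  apply/negP; rewrite -ltNge; apply: (@lt_le_trans _ _ 0); last first.
    by rewrite subr_ge0 F_nd// ltW.
  rewrite pmulr_llt0 ?subr_gt0// pmulr_llt0 ?invr_gt0// mulrBr bE.
  by rewrite addrAC subrr add0r oppr_lt0 mulr_gt0.
(* At [t = 0] the interval is taken to the right, below a positive support point; for [t > 0] to the
   left, where [t] may be the upper end. *)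
move: t0; rewrite le_eqVlt => /predU1P[t0|t0].
  have [s s0 si] := increase_point_gt0.
  pose q := Num.min r s; have q0 : 0 < q by rewrite lt_min r0.
  have qr : q <= r by rewrite ge_min lexx.
  have qs : q <= s by rewrite ge_min lexx orbT.
  exists (q / 3), (q / 2); split; try lra.
  - by apply: (@inner_pos s) => //; lra.
  - by apply: (@inner_pos s) => //; lra.
  by move=> x /andP[x1 x2]; rewrite -t0 subr0 gtr0_norm; lra.
pose q := Num.min r t; have q0 : 0 < q by rewrite lt_min r0.
have qr : q <= r by rewrite ge_min lexx.
have qt : q <= t by rewrite ge_min lexx orbT.
have inner x : 0 <= x -> x < t -> c x = ce.
  by move=> x0 /below[s xs si]; exact: inner_pos xs si.
exists (t - q / 2), (t - q / 3); split; try lra.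
- by apply: inner; lra.
- by apply: inner; lra.
by move=> x /andP[x1 x2]; rewrite ltr0_norm; lra.
Qed.

Lemma F_derive_neg s t : increase_point s -> s < t -> t < 0 ->
  is_derive t 1 F (alpha / K).
Proof.
move=> si st t0; apply: is_derive_slope => e e0.
exists (Num.min (t - s) (- t)); first by rewrite lt_min subr_gt0 st oppr_gt0.
have [s1 s10 s1i] := increase_point_gt0.
have near_ce x : `|x - t| < Num.min (t - s) (- t) -> x < 0 /\ c x = ce.
  rewrite lt_min !ltr_norml => /andP[/andP[sx _] /andP[_ x0]].
  have xneg : x < 0 by lra.
  split=> //; apply/c_eq/increase_point_inner.
    by apply: increase_point_ge si _; lra.
  by apply: increase_point_le s1i _; lra.
move=> u v /near_ce[u0 cu] /near_ce[v0 cv] uv.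
have -> : F v - F u = alpha / K * (v - u).
  move: cu cv; rewrite !c_neg ?ltW// => cu cv.
  apply: (mulIf (lt0r_neq0 K_gt0)); rewrite [RHS]mulrAC divfK ?gt_eqF//; lra.
have := mulr_ge0 (ltW e0) (_ : 0 <= v - u); rewrite subr_ge0 => /(_ uv) ?.
by apply/andP; split; lra.
Qed.

Lemma F_derive_pos s t : increase_point s -> 0 < t -> t < s ->
  is_derive t 1 F (((alpha + beta) * g t - beta) / K).
Proof.
move=> si t0 ts; apply: is_derive_slope => e e0.
(* An error [e1] in [g] changes the slope by [(alpha + beta) * e1 / K], which is [e]. *)
pose e1 := e * K / (alpha + beta).
have e10 : 0 < e1 by rewrite divr_gt0// mulr_gt0.
have [r r0 gr] := g_modulus t e10.
pose q := Num.min r (Num.min t (s - t)).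
exists q; first by rewrite !lt_min r0 t0 subr_gt0.
have near_ce x : `|x - t| < q -> [/\ 0 <= x, c x = ce & `|x - t| < r].
  rewrite !lt_min => /andP[-> /andP[]]; rewrite !ltr_norml => /andP[x0 _] /andP[_ xs].
  have x0' : 0 <= x by lra.
  by split=> //; apply: inner_pos si => //; lra.
move=> u v uq vq uv; have [u0 cu ur] := near_ce _ uq; have [v0 cv vr] := near_ce _ vq.
have gx x : u <= x <= v -> g t - e1 <= g x <= g t + e1.
  move=> /andP[ux xv]; have : `|x - t| < r.
    by move: ur vr; rewrite !ltr_norml => /andP[? ?] /andP[? ?]; apply/andP; split; lra.
  by move=> /gr; rewrite ltr_norml => /andP[? ?]; apply/andP; split; lra.
have := F_slope u0 uv cu cv gx.
have eE : (alpha + beta) * e1 / K = e.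
  by rewrite /e1 mulrCA divff ?mulr1 ?mulfK// gt_eqF.
have -> : ((alpha + beta) * (g t - e1) - beta) / K = ((alpha + beta) * g t - beta) / K - e.
  by rewrite -eE; ring.
have -> // : ((alpha + beta) * (g t + e1) - beta) / K = ((alpha + beta) * g t - beta) / K + e.
by rewrite -eE; ring.
Qed.

End Equilibrium.

(** * The density of arrivals *)

Section CdfLimits.
Variables (R : realType) (F : cumulativeBounded (0 : R) (1 : R)).

Lemma cdf_right_approx x y : F x < y -> exists2 z, x < z & F z < y.
Proof.
move=> Fxy; have Frc : F z @[z --> x^'+] --> F x.
  exact: cumulative_is_right_continuous.
have e0 : 0 < y - F x by rewrite subr_gt0.
have /cvgrPdist_lt /(_ _ e0) near1 := Frc.
have near2 : \forall z \near x^'+, x < z by exact: nbhs_right_gt.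
have [z [/= h xz]] := filter_ex (filterI near1 near2).
by exists z => //; move: h; rewrite ltr_norml => /andP[h _]; lra.
Qed.

Lemma cdf_lim0 e : 0 < e -> exists x, F x < e.
Proof.
move=> e0; have /cvgrPdist_lt /(_ _ e0) near0 := cumulativeNy F.
have [x /=] := filter_ex near0; rewrite sub0r normrN => h.
by exists x; exact: le_lt_trans (ler_norm _) h.
Qed.

Lemma cdf_lim1 e : 0 < e -> exists x, 1 - e < F x.
Proof.
move=> e0; have /cvgrPdist_lt /(_ _ e0) near1 := cumulativey F.
have [x /= h] := filter_ex near1.
by exists x; have := le_lt_trans (ler_norm _) h; lra.
Qed.

End CdfLimits.

(** * From the queue to an equilibrium profile *)

Section ModelProfile.
Variables (R : realType) (N : nat) (mu : R) (F : cumulativeBounded (0 : R) (1 : R)).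
Variables (d : measure_display) (Omega : measurableType d).
Variables (P : probability Omega R) (M : queue_model N mu F P).
Hypotheses (N_gt0 : (0 < N)%N) (mu_gt0 : 0 < mu).
Hypothesis no_atoms : forall i t, pr P [set w | arrival M i w = t] = 0.

(** Without atoms [F x] is the probability of arriving strictly before [x], and continuity of the
    measure along [x - n.+1%:R^-1] applies. *)
Lemma cdf_left_approx x y : y < F x -> exists2 z, z < x & y < F z.
Proof.
move=> yF; pose i := Ordinal N_gt0.
pose A (n : nat) := [set w | arrival M i w <= x - n.+1%:R^-1].
have mA n : measurable (A n) by exact: measurable_set_le.
have UA : \bigcup_n A n = [set w | arrival M i w < x].
  apply/seteqP; split=> w /=.
    by move=> [n _]; rewrite /A/= => /le_lt_trans; apply; rewrite ltrBlDr ltrDl.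
  move=> Tx; have [n] := ltr_add_invr Tx.
  by exists n => //; rewrite /A/= lerBrDr ltW.
have cvgA : P (A n) @[n --> \oo] --> P (\bigcup_n A n).
  apply: nondecreasing_cvg_mu => //.
    by rewrite UA; exact: measurable_set_lt.
  move=> m n mn; apply/subsetPset => w; rewrite /A/= => /le_trans; apply.
  by rewrite lerD2l lerN2 lef_pV2 ?posrE// ler_nat.
move: cvgA; rewrite UA -prE; last exact: measurable_set_lt.
rewrite pr_arrival_lt// => /fine_cvg /cvgrPdist_lt /(_ (F x - y)).
rewrite subr_gt0 => /(_ yF) near1.
have [n /=] := filter_ex near1; rewrite -/(pr P (A n)) (pr_arrival_le M i) => h.
exists (x - n.+1%:R^-1); first by rewrite ltrBlDr ltrDl.
by have := le_lt_trans (ler_norm _) h; lra.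
Qed.

(** Here [EA] is [N * F] and [EQ] is [N * F] minus the departures, so the waiting cost
    [(alpha + beta) / mu] and the index cost [gamma] per customer merge into one coefficient of
    [F]. *)
Lemma symmetric_equilibrium_profile (alpha beta gamma ce : R) :
  0 < alpha -> 0 <= beta -> 0 <= gamma ->
  (forall t, arrival_support F t -> cost M alpha beta gamma t = ce) ->
  (forall t, ce <= cost M alpha beta gamma t) ->
  equilibrium_profile F (fun t => pr P (present M t)) (fun t => departed M t / mu)
    (cost M alpha beta gamma) alpha beta mu N%:R
    (N%:R * (alpha + beta + gamma * mu) / mu) ce.
Proof.
move=> alpha_gt0 beta_ge0 gamma_ge0 ceE ce_le.
have NR : 0 < N%:R :> R by rewrite ltr0n.
have mi t := measurable_present_event M t.
have lep (i : 'I_N) x : 0 <= F x <= 1.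
  by rewrite -(pr_arrival_le M i) pr_ge0 pr_le1//; exact: measurable_set_le.
have D0 t : t <= 0 -> departed M t = 0 by exact: departed_le0.
have gm0 : 0 <= gamma * mu by rewrite mulr_ge0// ltW.
have abg0 : 0 < alpha + beta + gamma * mu by lra.
split=> //.
- by rewrite divr_gt0// mulr_gt0.
- by move=> x y; exact: cumulative_is_nondecreasing.
- exact: cdf_right_approx.
- exact: cdf_left_approx.
- by move=> x; have /andP[] := lep (Ordinal N_gt0) x.
- by move=> x; have /andP[] := lep (Ordinal N_gt0) x.
- exact: cdf_lim0.
- exact: cdf_lim1.
- by move=> u; exact: pr_present_le.
- by move=> u; exact: pr_ge0.
- by move=> u v; exact: pr_present_increase.
- by move=> u v; exact: pr_present_decrease.
- exact: pr_present0.
- by move=> u v; exact: pr_present_gap.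
- by rewrite D0// mul0r.
(* [departed_bounds] wants a nonnegative lower bound; since probabilities are nonnegative, [m] may
   be raised to [Num.max m 0]. *)
- move=> u v m u0 uv mg.
  have bounds x : u <= x <= v -> Num.max m 0 <= pr P (busy M x) <= 1.
    by move=> uxv; rewrite pr_busy// ge_max mg// pr_ge0 pr_le1.
  have m0 : 0 <= Num.max m 0 by rewrite le_max lexx orbT.
  have /andP[h _] := departed_bounds mu_gt0 u0 uv m0 bounds.
  rewrite -mulrBl ler_pdivlMr// mulrC (le_trans _ h)// ler_pM2l//.
  by rewrite ler_wpM2r ?subr_ge0// le_max lexx.
- move=> u v b u0 uv gb.
  have bounds x : u <= x <= v -> 0 <= pr P (busy M x) <= b.
    by move=> uxv; rewrite pr_busy// gb// pr_ge0.
  have /andP[_ h] := departed_bounds mu_gt0 u0 uv (lexx 0) bounds.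
  by rewrite -mulrBl ler_pdivrMr// mulrC.
- by move=> u; rewrite ler_pM2r ?invr_gt0//; exact: departed_le.
- move=> t t0; rewrite /cost EQ_sum EA_cdf// D0// subr0.
  have -> : beta * t * (0 <= t)%R%:R = 0.
    move: t0; rewrite le_eqVlt => /predU1P[->|t0]; first by rewrite mulr0 mul0r.
    by rewrite leNgt t0 mulr0.
  have -> : - alpha * t * (t < 0)%R%:R = - alpha * t.
    move: t0; rewrite le_eqVlt => /predU1P[->|->]; first by rewrite mulr0 mul0r.
    by rewrite mulr1.
  by field; rewrite gt_eqF.
- move=> t t0; rewrite /cost EQ_sum EA_cdf// ltNge t0 /= mulr0 mulr1.
  by field; rewrite gt_eqF.
Qed.

End ModelProfile.

Section PiecewiseDensity.
Variables (R : realType) (f : R -> R).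
Hypotheses (mf : measurable_fun setT f) (f_ge0 : forall x, 0 <= f x).
Local Notation leb := (@lebesgue_measure R).

Let mfE (A : set R) : measurable_fun A (EFin \o f).
Proof. by apply: measurable_funTS; exact/measurable_EFinP. Qed.

Lemma integral_increment u t : u <= t ->
  (\int[leb]_(x in `]-oo, t]) (f x)%:E =
   \int[leb]_(x in `]-oo, u]) (f x)%:E + \int[leb]_(x in `]u, t]) (f x)%:E)%E.
Proof.
move=> ut; rewrite (@itv_bndbnd_setU _ _ _ (BRight u)) ?bnd_simp//.
rewrite ge0_integral_setU//; first exact: mfE.
  by move=> x _; rewrite lee_fin.
apply/disj_setPS => x /= [] /=; rewrite !in_itv/= => xu /andP[].
by rewrite ltNge xu.
Qed.

Let length_oc u t : u <= t -> leb `]u, t] = (t - u)%:E.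
Proof.
move=> ut; rewrite lebesgue_measure_itv/= lte_fin.
by move: ut; rewrite le_eqVlt => /predU1P[->|->]//; rewrite ltxx subrr.
Qed.

Let length_oo u t : u <= t -> leb `]u, t[ = (t - u)%:E.
Proof.
move=> ut; rewrite lebesgue_measure_itv/= lte_fin.
by move: ut; rewrite le_eqVlt => /predU1P[->|->]//; rewrite ltxx subrr.
Qed.

(** Only values inside the open interval enter, so pieces can be glued where the density jumps. *)
Lemma integral_constant_piece u t a : u <= t ->
  (forall x, u < x -> x < t -> f x = a) ->
  (\int[leb]_(x in `]u, t]) (f x)%:E = (a * (t - u))%:E)%E.
Proof.
move=> ut fa; rewrite -integral_itv_bndo_bndc//.
have -> : (\int[leb]_(x in `]u, t[) (f x)%:E = \int[leb]_(x in `]u, t[) (cst a%:E) x)%E.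
  by apply: eq_integral => x; rewrite inE/= in_itv/= => /andP[? ?]; rewrite fa.
by rewrite integral_cst// -[X in (_ * X)%E]/(leb `]u, t[) length_oo.
Qed.

Lemma integral_left_null t : (forall x, x < t -> f x = 0) ->
  (\int[leb]_(x in `]-oo, t]) (f x)%:E = 0)%E.
Proof.
move=> f0; rewrite -integral_itv_bndo_bndc//.
by apply: integral0_eq => x; rewrite /= in_itv/= => /f0 ->.
Qed.

(* Stated with the nonnegative functions [f] and [p * g = f + q], so that no
   integrability is needed. *)
Lemma integral_affine_piece (g : R -> R) (t p q : R) :
  0 <= t -> 0 <= p -> 0 <= q -> (forall u, 0 <= g u) ->
  measurable_fun (`[0, +oo[%classic : set R) g ->
  (forall x, 0 < x -> x <= t -> f x = p * g x - q) ->
  (\int[leb]_(x in `]0%R, t]) (f x)%:E + (q * t)%:E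
   = p%:E * \int[leb]_(x in `[0%R, t]) (g x)%:E)%E.
Proof.
move=> t0 p0 q0 g0 mg fE.
have mg' : measurable_fun (`[0, t]%classic : set R) (EFin \o g).
  apply/measurable_EFinP; apply: measurable_funS mg => // x /=.
  by rewrite !in_itv/= andbT => /andP[].
have sub : (`]0, t]%classic : set R) `<=` `[0, t]%classic.
  by move=> x /=; rewrite !in_itv/= => /andP[/ltW -> ->].
rewrite -integral_itv_obnd_cbnd; last exact: measurable_funS sub mg'.
rewrite -ge0_integralZl//; [|exact: measurable_funS sub mg'|by move=> x _; rewrite lee_fin].
have -> : (q * t)%:E = (\int[leb]_(x in `]0%R, t]) (cst q%:E) x)%E.
  by rewrite integral_cst// -[X in (_ * X)%E]/(leb `]0, t]) length_oc// subr0.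
rewrite -ge0_integralD//; [|by move=> x _; rewrite lee_fin|exact: mfE].
apply: eq_integral => x; rewrite inE/= in_itv/= => /andP[x0 xt].
by rewrite fE// -EFinD -EFinM subrK.
Qed.

End PiecewiseDensity.

Lemma integral_pr_present (R : realType) (N : nat) (mu : R)
    (F : cumulativeBounded (0 : R) (1 : R)) (d : measure_display)
    (Omega : measurableType d) (P : probability Omega R)
    (M : queue_model N mu F P) :
  0 < mu -> (forall i t, pr P [set w | arrival M i w = t] = 0) -> forall t,
  (\int[lebesgue_measure]_(u in `[0%R, t]) (pr P (present M u))%:E
   = (departed M t / mu)%:E)%E.
Proof.
move=> mu0 na t; set I := (LHS).
have IE : I = (\int[lebesgue_measure]_(u in `[0%R, t]) P (busy M u))%E.
  apply: eq_integral => u _; rewrite -pr_busy// prE//; exact: measurable_busy.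
have := departedE M mu0 t; rewrite -IE => DE.
(* An infinite integral would make the real number [departed M t] infinite. *)
have Ifin : I \is a fin_num.
  have I0 : (0 <= I)%E by apply: integral_ge0 => u _; rewrite lee_fin pr_ge0.
  rewrite ge0_fin_numE//; move: DE I0; case: I {IE} => // [r|].
    by rewrite ltry.
  by rewrite gt0_muley ?lte_fin.
rewrite -(fineK Ifin); congr EFin; apply: (mulfI (lt0r_neq0 mu0)).
rewrite mulrCA divff ?mulr1 ?gt_eqF//; apply: EFin_inj.
by rewrite EFinM fineK// -DE.
Qed.

(** [tb] is an extended real since the bound of [increase_point_upper] divides by [beta]. A density
    is determined only almost everywhere, so [f] is also asserted to be the derivative of [F] inside
    the support, except at [0], where the two formulas may disagree. *)
Theorem theorem3p6 (R : realType) (N : nat) (alpha beta gamma mu : R)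
    (N_ge2 : (2 <= N)%N) (alpha_gt0 : 0 < alpha) (mu_gt0 : 0 < mu)
    (beta_ge0 : 0 <= beta) (gamma_ge0 : 0 <= gamma)
    (F : cumulativeBounded (0 : R) (1 : R))
    (d : measure_display) (Omega : measurableType d) (P : probability Omega R)
    (M : queue_model N mu F P)
    (F_regular : regular_support F)
    (F_equilibrium : symmetric_equilibrium M alpha beta gamma) :
  exists (ta : R) (tb : \bar R) (f : R -> R),
    [/\ ereal_inf (EFin @` arrival_support F) = ta%:E /\
        ereal_sup (EFin @` arrival_support F) = tb,
        [/\ ta < 0, (0 < tb)%E & 0 < beta -> (tb < +oo)%E],
        is_density F f /\
        (forall t, (ta < t /\ t < 0) \/ (0 < t /\ (t%:E < tb)%E) ->
           is_derive t 1 (F : R -> R) (f t)),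
        forall t, ta <= t -> t < 0 ->
          f t = alpha * mu / (N%:R * (alpha + beta + gamma * mu)) &
        forall t, 0 <= t -> (t%:E <= tb)%E ->
          f t = (mu * (alpha + beta) * (1 - PQ0 M t) - beta * mu)
                / (N%:R * (alpha + beta + gamma * mu))].
Proof.
have N_gt0 : (0 < N)%N by exact: ltnW.
have na i t := no_atom mu_gt0 i t alpha_gt0 beta_ge0 gamma_ge0 F_equilibrium.
have [ce [ceE ce_le]] := F_equilibrium.
have prof := symmetric_equilibrium_profile N_gt0 mu_gt0 na alpha_gt0 beta_ge0
  gamma_ge0 ceE ce_le.
set g := (fun t => pr P (present M t)) in prof.
set J := (fun t => departed M t / mu) in prof.
set c := cost M alpha beta gamma in prof.
set K := N%:R * (alpha + beta + gamma * mu) / mu in prof.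
pose S := arrival_support F.
have F_nd := profile_F_nd prof; have F_ge0 := profile_F_ge0 prof.
have F_le1 := profile_F_le1 prof.
have K0 := profile_K_gt0 prof; have F0 := F0_gt0 prof.
have ab0 : 0 < alpha + beta by lra.
have inner := increase_point_inner prof.
have S_ge x s : S s -> s < x -> 0 < F x := @increase_point_ge _ _ _ _ _ _ _ _ _ _ _ prof x s.
have S_le x s : S s -> x < s -> F x < 1 := @increase_point_le _ _ _ _ _ _ _ _ _ _ _ prof x s.
have [s1 s1_gt0 Ss1] := increase_point_gt0 prof.
have lbS : has_lbound S.
  by exists (- ce / alpha) => s; exact: (increase_point_lower prof).
pose ta := inf S; pose tb := ereal_sup (EFin @` S).
have taE : ereal_inf (EFin @` S) = ta%:E by apply: ereal_inf_EFin => //; exists s1.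
have ta_le s : S s -> ta <= s by move=> Ss; exact: ge_inf.
have le_tb s : S s -> (s%:E <= tb)%E by move=> Ss; apply: ereal_sup_ubound; exists s.
have above_ta x : ta < x -> 0 < F x.
  by move=> /(inf_lt (ex_intro _ s1 Ss1))[s Ss sx]; exact: S_ge sx.
have below_ta x : x <= ta -> F x = 0.
  move=> xta; apply/eqP; rewrite eq_le F_ge0 andbT leNgt; apply/negP.
  move=> /(profile_F_lc prof)[z zx /(left_increase_point prof)[s [sz _ Ss _]]].
  by have := ta_le s Ss; rewrite leNgt (le_lt_trans sz)// (lt_le_trans zx).
have below_tb x : (x%:E < tb)%E -> exists2 s, x < s & S s.
  by move=> /ereal_sup_gt[_ [s Ss <-]]; rewrite lte_fin; exists s.
have above_tb x : (tb < x%:E)%E -> F x = 1.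
  move=> tbx; apply/eqP; rewrite eq_le F_le1 leNgt; apply/negP.
  move=> /(right_increase_point prof)[s [xs _ Ss _]].
  by have := le_tb s Ss; rewrite leNgt (lt_le_trans tbx)// lee_fin.
have ta_lt0 : ta < 0.
  have [z z0 /(left_increase_point prof)[s [sz _ Ss _]]] := profile_F_lc prof F0.
  exact: le_lt_trans (ta_le s Ss) (le_lt_trans sz z0).
have tb_gt0 : (0 < tb)%E by apply: lt_le_trans (le_tb s1 Ss1); rewrite lte_fin.
(* Every point from [ta] to [tb], ends included, is a support point: [increase_point_inner] covers
   [0 < F t < 1]; at [ta], [F] vanishes to the left; where [F t] is [1], a support point above
   [t - e] is used. *)
have c_in t : ta <= t -> (t%:E <= tb)%E -> c t = ce.
  move=> tat ttb; apply: ceE => e e0; have [Ft|Ft] := ltP (F t) 1; last first.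
    have [|s es Ss] := below_tb (t - e).
      by apply: lt_le_trans ttb; rewrite lte_fin ltrBlDr ltrDl.
    apply: lt_le_trans (S_le _ _ Ss es) (le_trans Ft _).
    by apply: F_nd; rewrite lerDl ltW.
  move: tat; rewrite le_eqVlt => /predU1P[tat|/above_ta Ft0]; last exact: inner.
  rewrite below_ta ?above_ta// -tat; last by rewrite lerBlDr lerDl ltW.
  by rewrite ltrDl.
have c0 : c 0 = ce by apply: c_in; apply: ltW.
pose h t := ((alpha + beta) * g t - beta) / K.
have hE t : h t = (mu * (alpha + beta) * (1 - PQ0 M t) - beta * mu)
                / (N%:R * (alpha + beta + gamma * mu)).
  have DK : N%:R * (alpha + beta + gamma * mu) = K * mu.
    by rewrite /K divfK ?gt_eqF.
  by rewrite DK /h /g pr_present; field; rewrite !gt_eqF.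
have aE : alpha * mu / (N%:R * (alpha + beta + gamma * mu)) = alpha / K.
  have DK : N%:R * (alpha + beta + gamma * mu) = K * mu.
    by rewrite /K divfK ?gt_eqF.
  by rewrite DK; field; rewrite !gt_eqF.
have h_ge0 t : 0 <= t -> (t%:E <= tb)%E -> 0 <= h t.
  move=> t0 ttb; apply: (inflow_ge0 prof) => // x xt; apply: below_tb.
  by apply: lt_le_trans ttb; rewrite lte_fin.
(* The formulas are claimed at the end points [ta], [0] and [tb] as well, which fixes the side on
   which each piece is closed. *)
pose f t := if t < ta then 0 else if t < 0 then alpha / K
  else if (t%:E <= tb)%E then h t else 0.
have f_neg t : ta <= t -> t < 0 -> f t = alpha / K.
  by move=> tat t0; rewrite /f [t < ta]ltNge tat t0.
have f_pos t : 0 <= t -> (t%:E <= tb)%E -> f t = h t.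
  by move=> t0 ttb; rewrite /f ltNge (le_trans (ltW ta_lt0))// ltNge t0/= ttb.
have f_ge0 t : 0 <= f t.
  rewrite /f; case: ifP => // _; case: ltP => [_|t0].
    by rewrite divr_ge0// ltW.
  by case: ifP => // ttb; exact: h_ge0.
have gc : continuous g.
  move=> t; apply/cvgrPdist_lt => e e0; have [r r0 gr] := g_modulus prof t e0.
  apply/nbhs_ballP; exists r => //= s; rewrite /ball/= => ts.
  by rewrite distrC; apply: gr; rewrite distrC.
have mg : measurable_fun setT g by exact: continuous_measurable_fun.
have mf : measurable_fun setT f.
  apply: measurable_fun_ifT => //; first exact: measurable_fun_ltr.
  apply: measurable_fun_ifT => //; first exact: measurable_fun_ltr.
  apply: measurable_fun_ifT => //.
    by apply: measurable_fun_lee => //; exact: EFin_measurable.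
  by apply: measurable_funM => //; apply: measurable_funB => //; exact: measurable_funM.
have F_neg t : ta <= t -> t <= 0 -> F t = alpha / K * (t - ta).
  move=> tat t0; have := c_in ta (lexx ta); have := c_in t tat.
  have t_tb : (t%:E <= tb)%E.
    by apply: le_trans (ltW tb_gt0); rewrite lee_fin.
  have ta_tb : (ta%:E <= tb)%E.
    by apply: le_trans t_tb; rewrite lee_fin.
  move=> /(_ t_tb) + /(_ ta_tb).
  rewrite !(profile_c_neg prof) ?(ltW ta_lt0)// (below_ta ta)// mulr0 addr0 => ct cta.
  by apply: (mulIf (lt0r_neq0 K0)); rewrite [RHS]mulrAC divfK ?gt_eqF//; lra.
have int0 : (\int[lebesgue_measure]_(x in `]-oo, 0%R]) (f x)%:E = (F 0)%:E)%E.
  rewrite (integral_increment mf f_ge0 (ltW ta_lt0)).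
  rewrite (integral_left_null mf) ?add0e; last by move=> x xta; rewrite /f xta.
  rewrite (integral_constant_piece mf (ltW ta_lt0) (a := alpha / K)); last first.
    by move=> x tax x0; rewrite f_neg// ltW.
  by rewrite F_neg// ltW.
have int_pos t : 0 <= t -> (t%:E <= tb)%E ->
    (\int[lebesgue_measure]_(x in `]-oo, t]) (f x)%:E = (F t)%:E)%E.
  move=> t0 ttb; rewrite (integral_increment mf f_ge0 t0) int0.
  have := integral_affine_piece (g := g) mf f_ge0 t0
    (p := (alpha + beta) / K) (q := beta / K).
  rewrite integral_pr_present//.
  (* Equality of the costs at [0] and [t], solved for [F t]. *)
  have -> // : (F t)%:E = ((F 0)%:E + ((alpha + beta) / K * J t - beta / K * t)%:E)%E.
    have ct : c t = ce by apply: c_in => //; rewrite (le_trans (ltW ta_lt0)).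
    move: ct c0; rewrite !(profile_c_pos prof)// (profile_J0 prof) => ct c0'.
    have -> : F t = F 0 + ((alpha + beta) * J t - beta * t) / K.
      by apply: (mulIf (lt0r_neq0 K0)); rewrite mulrDl divfK ?gt_eqF//; lra.
    by rewrite -EFinD; congr EFin; ring.
  move=> I; congr (_ + _)%E; rewrite EFinB EFinM -I ?addeK//.
  - by rewrite divr_ge0// ltW.
  - by rewrite divr_ge0// ltW.
  - by move=> u; exact: pr_ge0.
  - exact: measurable_funTS.
  move=> x x0 xt; have xtb : (x%:E <= tb)%E by apply: le_trans ttb; rewrite lee_fin.
  by rewrite (f_pos x (ltW x0) xtb) /h mulrBl mulrAC.
exists ta, tb, f; split => //.
- split=> // b0; pose B := Num.max 0 ((ce + (alpha + beta) * (N%:R / mu)) / beta).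
  apply: (@le_lt_trans _ _ B%:E); last exact: ltry.
  apply: ge_ereal_sup => _ [s Ss <-]; rewrite lee_fin.
  exact: (increase_point_upper prof).
- split.
    split=> // t; have [tta|tat] := ltP t ta.
      rewrite below_ta ?(ltW tta)// (integral_left_null mf)// => x xt.
      by rewrite /f (lt_trans xt).
    have [t0|t0] := ltP t 0.
      rewrite (integral_increment mf f_ge0 tat).
      rewrite (integral_left_null mf) ?add0e; last by move=> x xta; rewrite /f xta.
      rewrite (integral_constant_piece mf tat (a := alpha / K)).
        by rewrite F_neg// ltW.
      by move=> x tax xt; rewrite f_neg ?(lt_trans xt)// ltW.
    have [ttb|tbt] := leP t%:E tb; first by rewrite int_pos.
    (* Beyond a finite [tb] the density is zero, and right continuity gives [F] the value [1]
       already at [tb]. *)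
    have [r rE] : exists r, tb = r%:E.
      by move: tbt (tb_gt0); case: (tb) => // r; exists r.
    have r0 : 0 <= r by rewrite -lee_fin -rE ltW.
    have rt : r < t by rewrite -lte_fin -rE.
    rewrite (integral_increment mf f_ge0 (ltW rt)) int_pos ?rE//.
    rewrite (integral_constant_piece mf (ltW rt) (a := 0)) ?mul0r ?adde0.
      rewrite above_tb//; congr EFin; apply/eqP; rewrite eq_le F_le1 leNgt.
      rewrite andbT; apply/negP => /(profile_F_rc prof)[z rz].
      by rewrite above_tb ?ltxx// rE lte_fin.
    move=> x rx xt; rewrite /f ltNge (ltW (lt_trans ta_lt0 (le_lt_trans r0 rx))).
    by rewrite /= ltNge (le_trans r0 (ltW rx))/= rE lee_fin leNgt rx.
  move=> t [[tat t0]|[t0 ttb]].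
    have [s Ss st] := inf_lt (ex_intro _ s1 Ss1) tat.
    by rewrite f_neg ?ltW//; exact: (F_derive_neg prof Ss st).
  have [s ts Ss] := below_tb t ttb.
  by rewrite f_pos ?ltW//; exact: (F_derive_pos prof Ss).
- by move=> t tat t0; rewrite aE f_neg.
- by move=> t t0 ttb; rewrite -hE f_pos.
Qed.
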